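(* Let $d,n\ge 1$ and let $W=\mathbb{Z}/d\mathbb{Z}\wr\mathfrak{S}_n$. For any Galois automorphism $\sigma\in\mathrm{Gal}(\mathbb{Q}[e^{2\pi i/d}]/\mathbb{Q})$ one has $$W^\sigma(t,q)=\sum_{w\in W} q^{\mathrm{fmaj}(w)}\,t^{\mathrm{fmaj}(\sigma(w^{-1}))}.$$
   Context: $W=\mathbb{Z}/d\mathbb{Z}\wr\mathfrak{S}_n$ is regarded as the complex reflection group in $GL(V)$, $V=\mathbb{C}^n$, of all $n\times n$ monomial matrices whose nonzero entries are $d$-th roots of unity. Its irreducible complex representations can be realized over $\mathbb{Q}[e^{2\pi i/d}]$. $W$ acts on $\mathbb{C}[V]=S(V^* )\cong\mathbb{C}[x_1,\dots,x_n]$ by the action induced from that on $V$; the coinvariant algebra is $A=\mathbb{C}[V]/(\mathbb{C}[V]^W_+)$, the quotient by the ideal generated by the invariants of positive degree, with graded pieces $A_i$. For an irreducible complex representation $\lambda$ of $W$ with character $\chi^\lambda$, the fake degree polynomial is $f^\lambda(q)=\sum_{i\ge0} q^i\langle\chi^\lambda, A_i\rangle_W$, where $\langle\cdot,\cdot\rangle_W$ is the inner product (intertwining number) of characters. For a Galois automorphism $\sigma$, $\sigma(\lambda)$ is the irreducible representation with character $\chi^{\sigma(\lambda)}(w)=\sigma(\chi^\lambda(w))$; $\overline{\lambda}$ is the complex conjugate (contragredient) representation. The $\sigma$-bimahonian distribution is $W^\sigma(t,q)=\sum_\lambda f^{\sigma(\lambda)}(t)\,f^{\overline{\lambda}}(q)$,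 summed over all irreducible complex representations $\lambda$ of $W$. Fix a primitive $d$-th root of unity $\omega$. For $w\in W$, $\sigma(w)\in W$ is the matrix obtained by applying $\sigma$ to the entries of $w$. An element $w\in W$ is written as a word $w_1\cdots w_n$, where $w_i=\omega^k j$ if $w$ sends the standard basis vector $e_i$ to $\omega^k e_j$ ($0\le k\le d-1$). The letters are linearly ordered by $$\omega^{d-1}1\prec\cdots\prec\omega^{d-1}n\prec\cdots\prec\omega^{1}1\prec\cdots\prec\omega^1 n\prec\omega^0 1\prec\cdots\prec\omega^0 n.$$ Let $r_k(w)$ be the number of letters $w_i$ of the form $\omega^k j$ with $1\le j\le n$, and let $\mathrm{maj}(w)=\sum i$, the sum over $i\in\{1,\dots,n-1\}$ with $w_{i+1}\prec w_i$. The flag major index is $$\mathrm{fmaj}(w)=d\cdot\mathrm{maj}(w)+\sum_{k=0}^{d-1}k\cdot r_k(w).$$ *)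

(* Defs.v *)
From HB Require Import structures.
From mathcomp Require Import all_boot all_order all_fingroup all_algebra.
From mathcomp Require Import all_solvable all_field all_character.
From mathcomp Require Export mpoly.

Set Implicit Arguments.
Unset Strict Implicit.
Unset Printing Implicit Defensive.

Import GRing.Theory Num.Theory passmx.
Local Open Scope ring_scope.

(* In Z/d wr S_n the element with permutation s and colours c stands for the  *)
(* monomial map e_i |-> omega^(c i) e_(s i), i.e. for the word whose i-th     *)
(* letter is omega^(c i) (s i) (indices start at 0).                          *)

Record wreath (d n : nat) :=
  Wreath { wperm : 'S_n; wcol : {ffun 'I_n -> 'I_d} }.

Definition wreath_pair d n (w : wreath d n) := (wperm w, wcol w).
Definition pair_wreath d n (p : 'S_n * {ffun 'I_n -> 'I_d}) : wreath d n :=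
  Wreath p.1 p.2.
Lemma wreath_pairK d n : cancel (@wreath_pair d n) (@pair_wreath d n).
Proof. by case. Qed.
HB.instance Definition _ d n :=
  Finite.copy (wreath d n) (can_type (@wreath_pairK d n)).

Section WreathGroup.
Variables d n : nat.
Implicit Types u v w : wreath d.+1 n.

(* The group structure is only declared for d.+1, where 'I_d.+1 = Z/(d.+1).   *)
(* Composition of maps: v acts first.  Permutations compose the other way     *)
(* round in the library, (s * t) i = t (s i).                                 *)
Definition wmul u v : wreath d.+1 n :=
  Wreath (wperm v * wperm u) [ffun i => wcol v i + wcol u (wperm v i)].
Definition wone : wreath d.+1 n := Wreath 1 [ffun=> 0].
Definition winv u : wreath d.+1 n :=
  Wreath (wperm u)^-1 [ffun i => - wcol u ((wperm u)^-1 i)%g].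

Lemma wmulA : associative wmul.
Proof.
move=> u v w; congr Wreath; first by rewrite /= mulgA.
by apply/ffunP=> i; rewrite !ffunE /= permM addrA.
Qed.

Lemma wmul1 : left_id wone wmul.
Proof.
case=> s c; congr Wreath; first by rewrite /= mulg1.
by apply/ffunP=> i; rewrite !ffunE addr0.
Qed.

Lemma wmulV : left_inverse wone winv wmul.
Proof.
move=> u; congr Wreath; first by rewrite /= mulgV.
by apply/ffunP=> i; rewrite !ffunE /= permK subrr.
Qed.

HB.instance Definition _ := Finite_isGroup.Build (wreath d.+1 n) wmulA wmul1 wmulV.

Lemma wpermM u v i : wperm (u * v)%g i = wperm u (wperm v i).
Proof. by rewrite permM. Qed.
Lemma wcolM u v i : wcol (u * v)%g i = wcol v i + wcol u (wperm v i).
Proof. by rewrite ffunE. Qed.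

End WreathGroup.

(* The monomial matrix, acting on column vectors, attached to zeta.           *)
Definition mono_mx (R : nzRingType) d n (zeta : R) (w : wreath d n) : 'M[R]_n :=
  \matrix_(i, j) (if i == wperm w j then zeta ^+ wcol w j else 0).

Section MonoMx.
Variables (F : fieldType) (d n : nat) (zeta : F).
Hypothesis zetaP : d.+1.-primitive_root zeta.
Implicit Types u v w : wreath d.+1 n.

Lemma mono_mx1 : mono_mx zeta (1%g : wreath d.+1 n) = 1%:M.
Proof.
apply/matrixP=> i j; rewrite !mxE perm1 ffunE expr0.
by case: eqP.
Qed.

Lemma mono_mxM u v : mono_mx zeta (u * v)%g = mono_mx zeta u *m mono_mx zeta v.
Proof.
apply/matrixP=> i j; rewrite !mxE wpermM wcolM.
rewrite (bigD1 (wperm v j)) //= !mxE eqxx big1 ?addr0; last first.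
  by move=> k /negbTE nk; rewrite !mxE nk mulr0.
case: ifP => _; last by rewrite mul0r.
by rewrite -exprD /= (prim_expr_mod zetaP) addnC.
Qed.

Lemma mono_mx_inj : injective (fun w => mono_mx zeta w).
Proof.
have zN0 k : zeta ^+ k != 0.
  apply: expf_neq0; apply/eqP=> z0; have := prim_expr_order zetaP.
  by rewrite z0 expr0n => /esym/eqP; rewrite oner_eq0.
move=> [s c] [s' c'] /matrixP E.
have Es : s = s'.
  apply/permP=> j; have := E (s j) j; rewrite !mxE eqxx /=.
  by case: eqP => // _ /eqP; rewrite (negbTE (zN0 _)).
subst s'; congr Wreath; apply/ffunP=> j; have := E (s j) j; rewrite !mxE eqxx /=.
move=> /eqP; rewrite (eq_prim_root_expr zetaP) !modn_small ?ltn_ord //.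
by move/eqP/val_inj.
Qed.

(* The image of mono_mx is the group of all monomial matrices whose nonzero   *)
(* entries are d.+1-st roots of unity.                                        *)
Lemma mono_mxP (M : 'M[F]_n) :
  (exists w : wreath d.+1 n, M = mono_mx zeta w) <->
  (exists s : 'S_n, forall i j, if i == s j then M i j ^+ d.+1 = 1 else M i j = 0).
Proof.
split=> [[w ->]|[s Ms]].
  exists (wperm w) => i j; rewrite mxE; case: (i == _) => //.
  by rewrite exprAC (prim_expr_order zetaP) expr1n.
have /fin_all_exists[c cP] j : exists k : 'I_d.+1, M (s j) j = zeta ^+ k.
  by have := Ms (s j) j; rewrite eqxx => /(prim_rootP zetaP)[k ->]; exists k.
exists (Wreath s (finfun c)); apply/matrixP=> i j; rewrite mxE ffunE /=.
by have := Ms i j; case: eqP => [-> _|//]; apply: cP.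
Qed.

End MonoMx.

Section FlagMajor.
Variables d n : nat.

(* The pair (k, j) is the letter omega^k j; higher powers of omega are smaller. *)
Definition letter := ('I_d * 'I_n)%type.
Definition letter_lt (a b : letter) : bool :=
  (b.1 < a.1)%N || (a.1 == b.1) && (a.2 < b.2)%N.

Variable w : wreath d n.

Definition word (i : 'I_n) : letter := (wcol w i, wperm w i).

(* The descent between positions i and i.+1 (from 0) contributes i.+1.        *)
Definition maj : nat :=
  \sum_(i < n | [exists j : 'I_n, (j == i.+1 :> nat) && letter_lt (word j) (word i)])
     i.+1.

Definition ncol (k : 'I_d) : nat := #|[set i | (word i).1 == k]|.

Definition fmaj : nat := (d * maj + \sum_(k < d) k * ncol k)%N.

End FlagMajor.

Section Coinvariants.
Variables (d n : nat) (omega : algC).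
Local Notation W := (wreath d.+1 n.+1).
Local Notation S := {mpoly algC[n.+1]}.
Implicit Types (u v w : W) (p q : S) (i : nat).

(* The natural left action on polynomial functions, (w p)(x) = p (w^-1 x).    *)
Definition pact w p : S :=
  p \mPo [tuple \sum_k mono_mx omega w^-1%g j k *: 'X_k | j < n.+1].

HB.instance Definition _ w := GRing.RMorphism.copy (pact w) (comp_mpoly _).
HB.instance Definition _ w := GRing.Linear.copy (pact w) (comp_mpoly _).

Definition pinvariant p : bool := [forall w, pact w p == p].

(* Membership in the ideal generated by the invariants with no constant term. *)
Definition coinv_ideal p : Prop :=
  exists2 s : seq (S * S),
    all (fun gh => pinvariant gh.2 && (gh.2@_0%MM == 0)) s
    & p = \sum_(gh <- s) gh.1 * gh.2.

Local Notation Sdeg i := (dhomog n.+1 algC i).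

Lemma pactXU w j : pact w 'X_j = \sum_k mono_mx omega w^-1%g j k *: 'X_k.
Proof. by rewrite /pact comp_mpolyXU -tnth_nth tnth_mktuple. Qed.

Lemma pactX w m : pact w 'X_[m] = \prod_j pact w 'X_j ^+ m j.
Proof. by rewrite mpolyXE_id rmorph_prod; apply: eq_bigr => j _; rewrite rmorphXn. Qed.

Lemma pact_homog i w p : p \is i.-homog -> pact w p \is i.-homog.
Proof.
move=> hp; rewrite [p]mpolyE linear_sum rpred_sum //= => m _.
have [/(dhomog_mf hp) <-|/memN_msupp_eq0 ->] := boolP (m \in msupp p);
  last by rewrite scale0r linear0 rpred0.
rewrite linearZ rpredZ //= pactX mdegE.
elim/big_rec2: _ => [|j e q _ hq]; first exact: dhomog1.
apply: dhomogM => //; rewrite -[X in X.-homog]mul1n; apply: dhomogMn.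
rewrite pactXU rpred_sum // => k _.
by rewrite rpredZ // dhomogX /= mdeg1.
Qed.

Lemma pact0E w p : (pact w p)@_0%MM = p@_0%MM.
Proof.
rewrite [p]mpolyE (linear_sum (pact w)) !(linear_sum (mcoeff _)).
apply: eq_bigr => m _; rewrite linearZ /= !mcoeffZ; congr (_ * _).
have homX : pact w 'X_[m] \is (mdeg m).-homog by rewrite pact_homog ?dhomogX.
have [->|mN0] := eqVneq m 0%MM; first by rewrite mpolyX0 rmorph1.
by rewrite (dhomog_nemf_coeff homX) ?mcoeffX ?(negbTE mN0) //= mdeg0 eq_sym mdeg_eq0.
Qed.

Definition pact_deg i w (p : Sdeg i) : Sdeg i := DHomog (pact_homog w (dhomog_is_dhomog p)).

Lemma pact_deg_linear i w : linear (@pact_deg i w).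
Proof. by move=> c p q; apply: val_inj; rewrite /= linearP. Qed.
HB.instance Definition _ i w :=
  GRing.isLinear.Build algC (Sdeg i) (Sdeg i) _ (@pact_deg i w) (@pact_deg_linear i w).

(* The degree i part of the ideal, see coinv_ideal_degP.                      *)
Definition coinv_ideal_deg i : {vspace Sdeg i} :=
  (\sum_(m : 'X_{1..n.+1 < i.+1, i.+1} |
          (mdeg m.2 != 0)%N && (mdeg m.1 + mdeg m.2 == i)%N)
     <[indhomog i ('X_[m.1] * \sum_w pact w 'X_[m.2])]>)%VS.

Definition hproj i q : Sdeg i := DHomog (pihomogP mdeg i q).
Lemma hproj_linear i : linear (hproj i).
Proof. by move=> c p q; apply: val_inj; rewrite /= linearP. Qed.
HB.instance Definition _ i :=
  GRing.isLinear.Build algC S (Sdeg i) _ (hproj i) (hproj_linear i).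

Lemma hprojK i (p : Sdeg i) : hproj i p = p.
Proof. by apply: val_inj; rewrite /= pihomog_dE ?dhomog_is_dhomog. Qed.

Lemma hprojE i p : p \is i.-homog -> hproj i p = indhomog i p.
Proof.
by move=> hp; apply: val_inj; rewrite /= pihomog_dE // /indhomog val_insubd hp.
Qed.

Lemma coinv_ideal0 : coinv_ideal 0.
Proof. by exists [::]; rewrite ?big_nil. Qed.

Lemma coinv_idealD p q : coinv_ideal p -> coinv_ideal q -> coinv_ideal (p + q).
Proof.
move=> [s hs ->] [t ht ->]; exists (s ++ t); last by rewrite big_cat.
by rewrite all_cat hs.
Qed.

Lemma coinv_idealM p q : coinv_ideal q -> coinv_ideal (p * q).
Proof.
move=> [s hs ->]; exists [seq (p * gh.1, gh.2) | gh <- s].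
  by rewrite all_map.
by rewrite big_map mulr_sumr; apply: eq_bigr => gh _; rewrite /= mulrA.
Qed.

Lemma coinv_idealZ c q : coinv_ideal q -> coinv_ideal (c *: q).
Proof. by rewrite -mul_mpolyC; apply: coinv_idealM. Qed.

Lemma mem_coinv_ideal p : pinvariant p -> p@_0%MM = 0 -> coinv_ideal p.
Proof.
move=> pI p0; exists [:: (1, p)]; first by rewrite /= pI p0 eqxx.
by rewrite big_seq1 mul1r.
Qed.

Lemma coinv_ideal_sum I (r : seq I) (P : pred I) (F : I -> S) :
  (forall k, P k -> coinv_ideal (F k)) -> coinv_ideal (\sum_(k <- r | P k) F k).
Proof. by move=> h; apply: big_ind => //; [apply: coinv_ideal0 | apply: coinv_idealD]. Qed.

Lemma pinvariantP p : reflect (forall w, pact w p = p) (pinvariant p).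
Proof. exact: 'forall_eqP. Qed.

Lemma coinv_ideal_pact w p : coinv_ideal p -> coinv_ideal (pact w p).
Proof.
move=> [s hs ->]; exists [seq (pact w gh.1, gh.2) | gh <- s].
  by rewrite all_map.
rewrite big_map linear_sum /= big_seq [RHS]big_seq; apply: eq_bigr => gh /(allP hs).
by case/andP=> /pinvariantP hI _; rewrite rmorphM /= hI.
Qed.

Section Theory.
Hypothesis omegaP : d.+1.-primitive_root omega.

Lemma eq_pact w (f : {lrmorphism S -> S}) :
  (forall j, pact w 'X_j = f 'X_j) -> pact w =1 f.
Proof.
move=> eqX p; rewrite [p]mpolyE !linear_sum; apply: eq_bigr => m _.
rewrite !linearZ /= pactX mpolyXE_id rmorph_prod; congr (_ *: _).
by apply: eq_bigr => j _; rewrite rmorphXn eqX.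
Qed.

Lemma pact1 p : pact 1%g p = p.
Proof.
apply: (@eq_pact 1%g idfun) => j; rewrite pactXU invg1 mono_mx1.
rewrite (bigD1 j) //= mxE eqxx scale1r big1 ?addr0 // => k /negbTE nk.
by rewrite mxE eq_sym nk scale0r.
Qed.

Lemma pactM u v p : pact (u * v)%g p = pact u (pact v p).
Proof.
apply: (@eq_pact _ (pact u \o pact v)) => j /=.
rewrite !pactXU linear_sum /= invMg (mono_mxM omegaP).
under [RHS]eq_bigr => k _ do rewrite linearZ /= pactXU scaler_sumr.
rewrite exchange_big /=; apply: eq_bigr => k _; rewrite mxE scaler_suml.
by apply: eq_bigr => l _; rewrite scalerA.
Qed.

Lemma pact_sumI p : pinvariant (\sum_w pact w p).
Proof.
apply/pinvariantP=> u; rewrite linear_sum /= [RHS](reindex_inj (mulgI u)).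
by apply: eq_bigr => v _; rewrite pactM.
Qed.

Lemma coinv_ideal_degP i (p : Sdeg i) :
  p \in coinv_ideal_deg i <-> coinv_ideal p.
Proof.
have homR m : \sum_w pact w 'X_[m] \is (mdeg m).-homog.
  by rewrite rpred_sum // => w _; rewrite pact_homog ?dhomogX.
have hom12 m1 m2 : 'X_[m1] * \sum_w pact w 'X_[m2] \is (mdeg m1 + mdeg m2).-homog.
  by rewrite dhomogM ?dhomogX.
split.
  case/memv_sumP=> f hf ->; rewrite raddf_sum; apply: coinv_ideal_sum => m Pm.
  have /vlineP[c ->] := hf m Pm; case/andP: Pm => m2N0 /eqP dm.
  have := hom12 m.1 m.2; rewrite dm => hm.
  apply: coinv_idealZ; rewrite -hprojE //= pihomog_dE //.
  apply: coinv_idealM; apply: mem_coinv_ideal; first exact: pact_sumI.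
  by rewrite (dhomog_nemf_coeff (homR _)) //= mdeg0 eq_sym.
case=> s hs Dp; rewrite -[p]hprojK Dp linear_sum /= big_seq.
apply: memv_suml => -[g h] /(allP hs)/= /andP[/pinvariantP hI /eqP h0].
have W0 : #|{: W}|%:R != 0 :> algC.
  by rewrite pnatr_eq0 -lt0n; apply/card_gt0P; exists 1%g.
have -> : h = #|{: W}|%:R^-1 *: \sum_w pact w h.
  rewrite (eq_bigr (fun=> h)) => [|w _]; last by rewrite hI.
  by rewrite sumr_const -scaler_nat scalerA mulVf ?scale1r.
rewrite -scalerAr linearZ memvZ //=.
have -> : \sum_w pact w h = \sum_(m <- msupp h) h@_m *: \sum_w pact w 'X_[m].
  rewrite (eq_bigr (fun w => \sum_(m <- msupp h) h@_m *: pact w 'X_[m])).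
    by rewrite exchange_big; apply: eq_bigr => m _; rewrite scaler_sumr.
  move=> w _; rewrite {1}[h]mpolyE (linear_sum (pact w)).
  by apply: eq_bigr => m _; rewrite linearZ.
rewrite [g]mpolyE mulr_suml (linear_sum (hproj i)); apply: memv_suml => m1 _.
rewrite mulr_sumr (linear_sum (hproj i)) /= big_seq; apply: memv_suml => m2 hm2.
rewrite -scalerAl -scalerAr !linearZ !memvZ //=.
have hm := hom12 m1 m2.
have [dm|dm] := eqVneq (mdeg m1 + mdeg m2)%N i; last first.
  rewrite (_ : hproj i _ = 0) ?mem0v //.
  by apply: val_inj; rewrite /= (pihomog_ne0 dm).
have m2N0 : mdeg m2 != 0%N.
  apply: contraTneq hm2 => /eqP; rewrite mdeg_eq0 => /eqP ->.
  by rewrite mcoeff_msupp h0 eqxx.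
have b1 : (mdeg m1 < i.+1)%N by rewrite ltnS -dm leq_addr.
have b2 : (mdeg m2 < i.+1)%N by rewrite ltnS -dm leq_addl.
rewrite dm in hm; rewrite hprojE //.
apply: (subvP (sumv_sup (BMultinom b1, BMultinom b2) _ (subvv _))) => /=.
  by rewrite m2N0 dm eqxx.
exact: memv_line.
Qed.

Let coinv_basis i := vbasis {:Sdeg i}.

(* The matrices of mx_representation act on row vectors on the right; the     *)
(* right action attached to the left action of W is p . w = w^-1 p.           *)
Definition poly_mx i w :=
  mxof (coinv_basis i) (coinv_basis i) (linfun (pact_deg (w^-1)%g)).

Lemma poly_mx_repr i : mx_repr [set: W] (@poly_mx i).
Proof.
have bP : basis_of {:Sdeg i} (coinv_basis i) by apply: vbasisP.
split=> [|u v _ _].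
  rewrite /poly_mx invg1 -[RHS](mxof1 (basis_free bP)); congr mxof.
  by apply/lfunP=> p; rewrite !lfunE /=; apply: val_inj; rewrite /= pact1.
rewrite /poly_mx -mxof_comp //; congr mxof.
apply/lfunP=> p; rewrite !lfunE /= !lfunE /=.
by apply: val_inj; rewrite /= invMg pactM.
Qed.
Canonical poly_repr i := MxRepresentation (poly_mx_repr i).

Lemma coinv_ideal_module i :
  mxmodule (poly_repr i) (msof (coinv_basis i) (coinv_ideal_deg i)).
Proof.
have bP : basis_of {:Sdeg i} (coinv_basis i) by apply: vbasisP.
apply/mxmoduleP=> w _; apply/row_subP=> k; rewrite row_mul /= /poly_mx.
rewrite mul_mxof -(mem_vecof bP) rVofK // lfunE /=.
apply/coinv_ideal_degP; apply/coinv_ideal_pact/coinv_ideal_degP.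
by rewrite mem_vecof // row_sub.
Qed.

(* A_i = C[V]_i / (C[V]_i meet the ideal), as a right module.                 *)
Definition coinv_repr i := factmod_repr (coinv_ideal_module i).

(* Back to the left action: w acts on A_i as the matrix of w^-1 above, so its *)
(* trace is the conjugate of the character of coinv_repr.                     *)
Definition coinv_char i : 'CF([set: W]) := ((cfRepr (coinv_repr i))^*)%CF.

(* <chi, A_i> = 0 for i > (dim V) * #|W|, see coef_fake_degree.               *)
Definition fake_degree (chi : 'CF([set: W])) : {poly algC} :=
  \poly_(i < (n.+1 * #|{: W}|).+1) '[chi, coinv_char i].

Lemma coinv_idealXn j : coinv_ideal ('X_j ^+ #|{: W}|).
Proof.
set N := #|{: W}|; pose P : {poly S} := \prod_w ('X - (pact w 'X_j)%:P).
have sP : size P = N.+1 by rewrite size_prod_XsubC /N cardT enumT [index_enum _]unlock.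
have PI u k : pact u P`_k = P`_k.
  rewrite -[LHS]coef_map (_ : map_poly (pact u) P = P) //.
  rewrite /P rmorph_prod [RHS](reindex_inj (mulgI u)); apply: eq_bigr => w _ /=.
  by rewrite map_polyXsubC /= pactM.
have P0 k : (k < N)%N -> P`_k@_0%MM = 0.
  move=> ltkN; rewrite -[LHS](coef_map (mcoeff 0%MM)) /P rmorph_prod.
  rewrite (eq_bigr (fun=> 'X)) => [|w _].
    by rewrite prodr_const coefXn ltn_eqF.
  by rewrite /= map_polyXsubC /= pact0E mcoeffX mnm1_eq0 subr0.
have : P.['X_j] = 0.
  rewrite /P (bigD1 (1%g : W)) //= hornerM hornerXsubC.
  by rewrite (pact1 'X_j) subrr mul0r.
rewrite horner_coef sP big_ord_recr /=.
have -> : P`_N = 1.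
  have := monic_prod_XsubC (index_enum W) xpredT (fun w => pact w 'X_j).
  by rewrite monicE lead_coefE -/P sP => /eqP.
rewrite mul1r addrC => /eqP; rewrite addr_eq0 => /eqP ->.
rewrite -scaleN1r; apply: coinv_idealZ; apply: coinv_ideal_sum => k _.
rewrite mulrC; apply: coinv_idealM; apply: mem_coinv_ideal; last exact: P0.
by apply/pinvariantP=> u; apply: PI.
Qed.

Lemma coinv_char_eq0 i : (n.+1 * #|{: W}| < i)%N -> coinv_char i = 0.
Proof.
set N := #|{: W}| => lti.
have full : coinv_ideal_deg i = fullv.
  apply/eqP; rewrite eqEsubv subvf; apply/subvP=> p _; apply/coinv_ideal_degP.
  rewrite [val p]mpolyE big_seq; apply: coinv_ideal_sum => m hm.
  apply: coinv_idealZ.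
  have dm : mdeg m = i := dhomog_mf (dhomog_is_dhomog p) hm.
  have /existsP[j hj] : [exists j, (N <= m j)%N].
    apply: contraLR lti; rewrite negb_exists -leqNgt => /forallP lt_m.
    rewrite -dm mdegE -[X in (X * _)%N]card_ord -sum_nat_const leq_sum // => j _.
    by rewrite ltnW // ltnNge lt_m.
  rewrite mpolyXE_id (bigD1 j) //= mulrC -(subnK hj) exprD mulrA.
  by apply: coinv_idealM; apply: coinv_idealXn.
have rk0 : \rank (cokermx (msof (coinv_basis i) (coinv_ideal_deg i))) = 0%N.
  have bP : basis_of {:Sdeg i} (coinv_basis i) by apply: vbasisP.
  suff /eqP E : row_full (msof (coinv_basis i) (coinv_ideal_deg i)).
    by rewrite mxrank_coker E subnn.
  rewrite -sub1mx; apply/row_subP=> k.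
  by rewrite -(mem_vecof bP) full memvf.
apply/cfunP=> w; rewrite /coinv_char cfunE [in LHS]cfunE cfunE.
rewrite /mxtrace big1 ?mul0rn ?rmorph0 // => -[k ltk] _.
by exfalso; move: ltk; rewrite rk0.
Qed.

Lemma coef_fake_degree chi i : (fake_degree chi)`_i = '[chi, coinv_char i].
Proof.
rewrite coef_poly; case: ifP => // /negbT; rewrite -leqNgt => hi.
by rewrite coinv_char_eq0 ?cfdot0r.
Qed.

End Theory.
End Coinvariants.

(* Below, K is a model of Q[e^(2 i pi / d.+1)]: it is generated by a          *)
(* primitive root zeta, and embedded in algC by iota.                         *)
Lemma cyclotomic_model d :
  exists (K : splittingFieldType rat) (iota : {rmorphism K -> algC}) (zeta : K),
    d.+1.-primitive_root zeta /\ <<1; zeta>>%VS = fullv.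
Proof.
have [K _ [iota _ [z [zP zgen] _]]] := group_num_field_exists [set: 'I_d.+1]%G.
by rewrite cardsT card_ord in zP; exists K, iota, z.
Qed.

Section Galois.
Variables (d n : nat) (K : splittingFieldType rat) (iota : {rmorphism K -> algC}).
Variables (zeta : K) (sigma : gal_of {:K}).
Local Notation W := (wreath d.+1 n.+1).
Hypothesis zetaP : d.+1.-primitive_root zeta.

(* The element of W whose matrix is obtained by applying sigma to the entries *)
(* of that of w; it exists, see mono_mx_gal.                                  *)
Definition gal_wreath (w : W) : W :=
  odflt w [pick w' | mono_mx zeta w' == map_mx sigma (mono_mx zeta w)].

Lemma mono_mx_gal w : mono_mx zeta (gal_wreath w) = map_mx sigma (mono_mx zeta w).
Proof.
rewrite /gal_wreath; case: pickP => [w' /eqP //|no].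
have /(mono_mxP zetaP)[w' Ew'] : exists s : 'S_n.+1, forall i j,
    if i == s j then map_mx sigma (mono_mx zeta w) i j ^+ d.+1 = 1
    else map_mx sigma (mono_mx zeta w) i j = 0.
  exists (wperm w) => i j; rewrite !mxE; case: (i == _); last by rewrite rmorph0.
  by rewrite -rmorphXn exprAC (prim_expr_order zetaP) expr1n rmorph1.
by have := no w'; rewrite -Ew' eqxx.
Qed.

(* sigma extended to algC through iota: this only serves to apply sigma to    *)
(* character values, and these lie in the image of iota.                      *)
Definition gal_ext : {rmorphism algC -> algC} :=
  sval (extend_algC_subfield_aut iota sigma).

Lemma gal_extE x : gal_ext (iota x) = iota (sigma x).
Proof. by rewrite /gal_ext; case: extend_algC_subfield_aut => nu /= ->. Qed.

Definition gal_Iirr (l : Iirr [set: W]) : Iirr [set: W] := aut_Iirr gal_ext l.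

Lemma gal_IirrE l w x :
  'chi_l w = iota x -> 'chi_(gal_Iirr l) w = iota (sigma x).
Proof. by move=> Dx; rewrite aut_IirrE cfunE Dx gal_extE. Qed.

Lemma iota_prim_root : d.+1.-primitive_root (iota zeta).
Proof. by rewrite fmorph_primitive_root. Qed.

(* Polynomials in two variables: t is the outer 'X and q the inner one, so    *)
(* that f^:P stands for f(t) and f%:P for f(q).                               *)
Definition bimahonian : {poly {poly algC}} :=
  \sum_(l : Iirr [set: W])
    (fake_degree iota_prim_root 'chi_(gal_Iirr l)) ^:P
    * (fake_degree iota_prim_root 'chi_(conjC_Iirr l))%:P.

End Galois.

(* Main.v *)
From HB Require Import structures.
Require Import Defs.
From mathcomp Require Import all_boot all_order all_fingroup all_algebra.
From mathcomp Require Import all_solvable all_field all_character.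
From mathcomp Require Import zify ring ssrcomplements.

(* Write theta_k for the k-th elementary symmetric polynomial in the D-th       *)
(* powers of the N variables, where D = d.+1 and N = n.+1.  Sorting an exponent *)
(* b yields an element [eword b] of W, and the exponents with a given word u    *)
(* are the sums of a least one, [delta u], of degree fmaj u, and of a           *)
(* rearrangement of D times a partition.  The products of the monomials         *)
(* x^(delta u) (the descent monomials of Garsia and Stanton) with monomials in  *)
(* the theta_k are triangular with respect to the monomials, hence a basis of   *)
(* C[V].  Since the theta_k are invariant and generate the ideal of positive    *)
(* degree invariants, the graded character of C[V] is the convolution of that   *)
(* of the coinvariant algebra A with the number of partitions.                  *)
(* By orthogonality the coefficient of t^i q^j in the sigma-bimahonian          *)
(* distribution is |W|^-1 sum_w A_i(w) sigma(A_j(w)).  Replacing A by C[V], this *)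
(* sum counts the orbits of the pairs of exponents (a, b) with b + r a = 0      *)
(* mod D, where sigma zeta = zeta^r.  Such orbits correspond to the pairs of    *)
(* exponents with eword b = sigma((eword a)^-1), and the convolutions with the  *)
(* number of partitions on both sides cancel.                                   *)

Set Implicit Arguments.
Unset Strict Implicit.
Unset Printing Implicit Defensive.

Import GRing.Theory Num.Theory passmx.

(** * Words of exponents *)

(** Write D for [d.+1] and N for the number of variables. Both sides of the identity become explicit
    counts of pairs of exponents once they are multiplied, in t and in q, by the generating series
    of partitions with at most N parts, all divisible by D.

    For words, [count_eword] does this: the exponents with word u contribute q^(fmaj u) times that
    series. For characters, [dinvK] and [dlinK] show that the [dmon b] are a basis of C[V], and
    [dinv_theta] that multiplication by [theta k] becomes the shift [raising k] of this basis. As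
    the [theta k] are invariant ([pact_theta]) and generate the coinvariant ideal
    ([coinv_theta_ideal]), the trace of w on C[V] is its trace on A convolved with the same
    partition numbers ([trace_pact_conv]).

    By orthogonality ([coef_bimahonian]), the coefficients of the distribution are averages over W
    of products of traces on A. With C[V] in place of A, summing over colours forces b + r a = 0 mod
    D, and summing over permutations counts orbits ([sum_trace_pact]); [eword_twist] matches these
    orbits with the pairs such that [eword b] is the twist of the inverse of [eword a]. Both sides
    thus agree after two convolutions, which [conv_inj] removes in [sum_coinv_char]. *)

Lemma card_ord_lt n m : (m <= n)%N -> #|[pred q : 'I_n | (q < m)%N]| = m.
Proof.
move=> le_mn; rewrite -sum1_card -(big_ord_widen _ (fun=> 1)%N le_mn).
by rewrite sum1_card card_ord.
Qed.

Lemma mnm_gt0_exists n (m : 'X_{1..n}) : m != 0%MM -> exists i, (0 < m i)%N.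
Proof.
move/eqP=> mN0; apply/existsP; apply: contra_notT mN0 => /existsPn m0.
by apply/mnmP=> i; rewrite mnm0E; have := m0 i; lia.
Qed.

Section Words.
Variables d n : nat.
Implicit Types (b c : 'X_{1..n}) (i j k p q : 'I_n) (s : 'S_n) (u : wreath d.+1 n).

(** The order in which variables are read: by decreasing exponent, ties by increasing index.
    [rkperm b] sends a variable to its position, counted from 0. *)
Definition before b i j := (b j < b i)%N || (b i == b j) && (i < j)%N.

Lemma before_irr b i : before b i i = false.
Proof. by rewrite /before !ltnn andbF. Qed.

Lemma before_trans b : transitive (before b).
Proof. by rewrite /before => j i k; lia. Qed.

Lemma before_total b i j : i != j -> before b i j || before b j i.
Proof. by rewrite /before -val_eqE /=; lia. Qed.

Definition rk b i := #|[set j | before b j i]|.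

Lemma rk_lt b i j : before b i j -> (rk b i < rk b j)%N.
Proof.
move=> ij; apply: proper_card; apply/properP; split.
  by apply/subsetP=> k; rewrite !inE => /before_trans; apply.
by exists i; rewrite !inE ?before_irr.
Qed.

Lemma rk_ub b i : (rk b i < n)%N.
Proof.
rewrite -[X in (_ < X)%N]card_ord -cardsT; apply: proper_card.
by apply/properP; split=> //; exists i; rewrite !inE ?before_irr.
Qed.

Lemma rk_inj b : injective (fun i => Ordinal (rk_ub b i)).
Proof.
move=> i j [] eq_rk; apply/eqP; apply/negPn/negP => /(before_total b).
by case/orP=> /rk_lt; rewrite eq_rk ltnn.
Qed.

Definition rkperm b : 'S_n := perm (@rk_inj b).

Lemma before_rk b i j : before b i j = (rkperm b i < rkperm b j)%N.
Proof.
rewrite !permE /=; apply/idP/idP=> [/rk_lt//|]; have [->|ij] := eqVneq i j.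
  by rewrite ltnn.
by case/orP: (before_total b ij) => // /rk_lt; lia.
Qed.

Lemma consecutive_trans (r : rel 'I_n) : transitive r ->
  (forall p q, q = p.+1 :> nat -> r p q) -> forall p q, (p < q)%N -> r p q.
Proof.
move=> tr r1 p [m lt_mn] /=; elim: m lt_mn => // m IHm lt_mn; rewrite ltnS leq_eqVlt.
case/orP=> [/eqP eq_pm|lt_pm]; first by apply: r1; rewrite /= eq_pm.
have lt_mn' : (m < n)%N by lia.
by apply: tr (IHm lt_mn' lt_pm) _; apply: r1.
Qed.

Lemma rkperm_uniq b s :
  (forall p q, q = p.+1 :> nat -> before b (s p) (s q)) -> rkperm b = s^-1%g.
Proof.
move=> sb; have {}sb p q : (p < q)%N -> before b (s p) (s q).
  move: p q; apply: (consecutive_trans (r := fun p q => before b (s p) (s q))) => //.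
  by move=> ? ? ?; apply: before_trans.
apply/permP=> i; apply: val_inj; rewrite -[i in LHS](permKV s).
set p := (s^-1 i)%g; rewrite permE /= /rk.
have -> : [set j | before b j (s p)] = s @: [set q : 'I_n | (q < p)%N].
  apply/setP=> j; rewrite -[j](permKV s) (mem_imset _ _ perm_inj) !inE.
  set q := (s^-1 j)%g; case: (ltngtP q p) => [/sb ->//|/sb|/val_inj ->].
    by rewrite /before; lia.
  by rewrite before_irr.
rewrite card_imset; last exact: perm_inj.
by rewrite cardsE card_ord_lt // ltnW.
Qed.

(** Position p holds the p-th variable in the order [before b], coloured by its exponent mod D. *)
Definition eword b : wreath d.+1 n :=
  Wreath (rkperm b)^-1 [ffun p => inZp (b ((rkperm b)^-1%g p))].

Definition desc u p : bool :=
  [exists q : 'I_n, (q == p.+1 :> nat) && letter_lt (word u q) (word u p)].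

Lemma descE u p q : q = p.+1 :> nat -> desc u p = letter_lt (word u q) (word u p).
Proof.
move=> eq_q; apply/existsP/idP=> [[q' /andP[/eqP eq_q']]|]; last first.
  by exists q; rewrite eq_q eqxx.
by rewrite (val_inj (etrans eq_q' (esym eq_q))).
Qed.

(** Divide both exponents by D. When the quotients agree, the order is decided by the residues and
    then by the indices, which is how letters compare; so a descent is exactly what forces a strict
    drop of the quotient. *)
Lemma before_desc b u p q : q = p.+1 :> nat ->
    (forall p, wcol u p = b (wperm u p) %% d.+1 :> nat)%N ->
  before b (wperm u p) (wperm u q)
    = (b (wperm u q) %/ d.+1 + desc u p <= b (wperm u p) %/ d.+1)%N.
Proof.
move=> eq_q col_u; rewrite (descE _ eq_q) /before /letter_lt /= -val_eqE /= !col_u.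
have : wperm u p != wperm u q.
  by rewrite (inj_eq perm_inj) -val_eqE /= eq_q neq_ltn ltnSn.
rewrite -val_eqE /=; move: (wperm u p) (wperm u q) => i j neq_ij.
have := divn_eq (b i) d.+1; have := divn_eq (b j) d.+1.
have := ltn_mod (b i) d.+1; have := ltn_mod (b j) d.+1.
set ai := (b i %/ _)%N; set aj := (b j %/ _)%N.
set ri := (b i %% _)%N; set rj := (b j %% _)%N.
move=> lj li -> ->.
case: (ltngtP ai aj) => [a|a|<-].
- by have := leq_mul2r d.+1 ai.+1 aj; rewrite a /= mulSn; lia.
- by have := leq_mul2r d.+1 aj.+1 ai; rewrite a /= mulSn; lia.
- by rewrite ltn_add2l eqn_add2l; lia.
Qed.

Lemma ewordP b u : reflect
  ((forall p, wcol u p = b (wperm u p) %% d.+1 :> nat)%N /\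
   (forall p q, q = p.+1 :> nat ->
      b (wperm u q) %/ d.+1 + desc u p <= b (wperm u p) %/ d.+1)%N)
  (eword b == u).
Proof.
apply: (iffP eqP) => [<-|[col_u desc_u]].
  have col_b p : wcol (eword b) p = (b (wperm (eword b) p) %% d.+1)%N :> nat.
    by rewrite ffunE.
  split=> // p q eq_q; rewrite -before_desc // before_rk /= !permKV.
  by rewrite eq_q.
have rkE : rkperm b = (wperm u)^-1%g.
  by apply: rkperm_uniq => p q eq_q; rewrite before_desc ?desc_u.
rewrite /eword; case: u col_u {desc_u} rkE => s c /= col_u rkE.
rewrite rkE invgK; congr Wreath; apply/ffunP=> p; apply: val_inj.
by rewrite ffunE /= col_u.
Qed.

Lemma sum_desc_rec u p q : q = p.+1 :> nat ->
  (\sum_(i < n | p <= i) desc u i = desc u p + \sum_(i < n | q <= i) desc u i)%N.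
Proof.
move=> eq_q; rewrite (bigD1 p) //=; congr (_ + _)%N; apply: eq_bigl => i.
by rewrite -val_eqE /=; lia.
Qed.

(** The exponent of the descent monomial of u: in [ewordP], the quotient at p is at least the number
    of descents from p on. *)
Definition delta u : 'X_{1..n} :=
  [multinom (d.+1 * (\sum_(q < n | (wperm u)^-1%g i <= q) desc u q)
             + wcol u ((wperm u)^-1%g i))%N | i < n].

Lemma deltaE u p :
  delta u (wperm u p) = (d.+1 * (\sum_(q < n | p <= q) desc u q) + wcol u p)%N.
Proof. by rewrite mnmE permK. Qed.

(* [d.+1] times a partition *)
Definition ispart c : bool :=
  [forall p, d.+1 %| c p]
  && [forall p : 'I_n, forall q : 'I_n, (q == p.+1 :> nat) ==> (c q <= c p)%N].

Lemma ispartP c : reflect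
  ((forall p, d.+1 %| c p) /\ (forall p q, q = p.+1 :> nat -> c q <= c p)%N) (ispart c).
Proof.
apply: (iffP andP) => [[/forallP dv /forallP mono]|[dv mono]]; split=> //.
- by move=> p q /eqP eq_q; have /forallP/(_ q)/implyP := mono p; apply.
- exact/forallP.
- by apply/forallP=> p; apply/forallP=> q; apply/implyP=> /eqP; apply: mono.
Qed.

Definition place s c : 'X_{1..n} := [multinom c (s i) | i < n].

Lemma placeE s c i : place s c i = c (s i).
Proof. exact: mnmE. Qed.

Lemma placeK s c : place s (place s^-1%g c) = c.
Proof. by apply/mnmP=> i; rewrite !mnmE permK. Qed.

Lemma placeVK s c : place s^-1%g (place s c) = c.
Proof. by apply/mnmP=> i; rewrite !mnmE permKV. Qed.

Lemma mdeg_place s c : mdeg (place s c) = mdeg c.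
Proof. exact: mdeg_mperm. Qed.

Lemma eword_delta_add u c : ispart c -> eword (delta u + place (wperm u)^-1 c) = u.
Proof.
case/ispartP=> dv mono; apply/eqP/ewordP.
have bE p : (delta u + place (wperm u)^-1 c)%MM (wperm u p)
      = ((\sum_(q < n | p <= q) desc u q + c p %/ d.+1) * d.+1 + wcol u p)%N.
  by rewrite mnmDE deltaE mnmE permK -{1}(divnK (dv p)) addnAC mulnC -mulnDl.
split=> [p|p q eq_q]; first by rewrite bE modnMDl modn_small.
rewrite !bE !divnMDl // !(divn_small (ltn_ord _)) !addn0.
rewrite (sum_desc_rec _ eq_q) addnAC [X in (X + _)%N]addnC.
by rewrite leq_add2l leq_div2r ?mono.
Qed.

Lemma eword_delta u : eword (delta u) = u.
Proof.
rewrite -[RHS](@eword_delta_add u 0%MM); last by apply/ispartP; split=> *; rewrite !mnm0E.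
by congr eword; apply/mnmP=> i; rewrite mnmDE !mnmE addn0.
Qed.

(** By induction from the last position, which carries no descent, towards the first. *)
Lemma delta_wperm_le b p :
  (delta (eword b) (wperm (eword b) p) <= b (wperm (eword b) p))%N
  /\ forall q, q = p.+1 :> nat ->
    (b (wperm (eword b) q) - delta (eword b) (wperm (eword b) q)
     <= b (wperm (eword b) p) - delta (eword b) (wperm (eword b) p))%N.
Proof.
set u := eword b; have /ewordP[col_u desc_u] := eqxx u.
have bE p' : b (wperm u p') = (d.+1 * (b (wperm u p') %/ d.+1) + wcol u p')%N.
  by rewrite col_u mulnC -divn_eq.
have ub p' : (\sum_(q < n | p' <= q) desc u q <= b (wperm u p') %/ d.+1)%N.
  move: {2}(n - p')%N (leqnn (n - p')) => m; elim: m p' => [|m IHm] p'.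
    by have := ltn_ord p'; lia.
  move=> le_m; case: (ltnP p'.+1 n) => [lt_p|ge_p].
    rewrite (@sum_desc_rec u p' (Ordinal lt_p)) //.
    have := IHm (Ordinal lt_p); have := desc_u p' (Ordinal lt_p) (erefl _).
    move=> /=; lia.
  have nd : desc u p' = false.
    by apply/existsP=> -[q /andP[/eqP eq_q _]]; have := ltn_ord q; lia.
  rewrite big1 // => q le_q; rewrite (_ : q = p') ?nd //.
  by apply: ord_inj; have := ltn_ord q; lia.
split=> [|q eq_q]; first by rewrite deltaE (bE p) leq_add2r leq_mul2l ub.
rewrite !deltaE (bE p) (bE q) !subnDr -!mulnBr leq_pmul2l // (sum_desc_rec _ eq_q).
by have := desc_u _ _ eq_q; have := ub q; lia.
Qed.

Lemma delta_le b : (delta (eword b) <= b)%MM.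
Proof.
apply/mnm_lepP=> i; rewrite -[i](permKV (wperm (eword b))).
by case: (delta_wperm_le b ((wperm (eword b))^-1%g i)).
Qed.

Definition epart b : 'X_{1..n} := place (wperm (eword b)) (b - delta (eword b))%MM.

Lemma ispart_epart b : ispart (epart b).
Proof.
apply/ispartP; split=> [p|p q eq_q]; rewrite /epart !placeE !mnmBE; last first.
  by have [_] := delta_wperm_le b p; apply.
have /ewordP[col_u _] := eqxx (eword b).
rewrite deltaE col_u {1}(divn_eq (b _) d.+1) subnDr mulnC -mulnBr.
exact: dvdn_mulr.
Qed.

Lemma epartK b : (delta (eword b) + place (wperm (eword b))^-1 (epart b))%MM = b.
Proof. by rewrite /epart placeVK addmC submK ?delta_le. Qed.

(** Double counting: a descent at q is counted at the positions 0, ..., q, hence [q.+1] times, its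
    weight in [maj]. *)
Lemma mdeg_delta u : mdeg (delta u) = fmaj u.
Proof.
rewrite mdegE (reindex_inj (@perm_inj _ (wperm u))) /=.
under eq_bigr do rewrite deltaE.
rewrite big_split /= -big_distrr /= /fmaj; congr (_ * _ + _)%N.
  rewrite (exchange_big_dep xpredT) //= /maj [RHS]big_mkcond /=.
  apply: eq_bigr => q _; rewrite -/(desc u q).
  rewrite sum_nat_const [X in (X * _)%N](_ : _ = q.+1) //; last first.
    by rewrite -(card_ord_lt (ltn_ord q)); apply: eq_card.
  by case: (desc u q); rewrite ?muln1 ?muln0.
rewrite (partition_big (wcol u) xpredT) //=; apply: eq_bigr => k _.
rewrite (eq_bigr (fun=> k : nat)) => [|p /eqP -> //].
by rewrite sum_nat_const mulnC; congr (_ * _)%N; rewrite /ncol cardsE.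
Qed.

End Words.

(** * Pairs of exponents up to permutation *)

Definition monos n i : seq 'X_{1..n} :=
  [seq s2m t | t : i.-tuple 'I_n <- enum (mpoly.basis n i)].

Lemma mem_monos n i (m : 'X_{1..n}) : (m \in monos n i) = (mdeg m == i).
Proof. by rewrite basis_cover. Qed.

Lemma uniq_monos n i : uniq (monos n i).
Proof. exact: uniq_basis. Qed.

Lemma perm_monos n i (s : 'S_n) : perm_eq [seq place s b | b <- monos n i] (monos n i).
Proof.
apply: uniq_perm; rewrite ?uniq_monos //.
  by rewrite map_inj_uniq ?uniq_monos //; apply: (can_inj (placeVK s)).
move=> b; apply/mapP/idP=> [[c]|bi]; first by rewrite !mem_monos => ci ->; rewrite mdeg_place.
by exists (place s^-1 b); rewrite ?placeK // mem_monos mdeg_place -mem_monos.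
Qed.

Section Counting.
Variables d n : nat.
Implicit Types (a b c : 'X_{1..n}) (i j k : nat) (p q : 'I_n) (s : 'S_n) (u : wreath d.+1 n).

Definition npart k := count (@ispart d n) (monos n k).

Lemma npart0 : npart 0 = 1%N.
Proof.
have eq_monos : perm_eq (monos n 0) [:: 0%MM].
  apply: uniq_perm; rewrite ?uniq_monos // => m.
  by rewrite mem_monos mdeg_eq0 inE.
rewrite /npart (seq.permP eq_monos) /= addn0 (_ : ispart d 0) //.
by apply/ispartP; split=> *; rewrite !mnm0E.
Qed.

(** For a fixed word u, [epart] is a bijection onto the multiples of D of partitions, and it lowers
    the degree by [fmaj u]. *)
Lemma count_eword u i :
  count (fun b => eword d b == u) (monos n i)
    = if (fmaj u <= i)%N then npart (i - fmaj u) else 0%N.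
Proof.
case: leqP => [le_ui|lt_iu]; last first.
  apply/eqP; rewrite -leqn0 leqNgt -has_count; apply/hasPn => b; rewrite mem_monos => /eqP b_i.
  apply: contraTN lt_iu => /eqP <-; rewrite -leqNgt -b_i -[b in mdeg b](epartK d).
  by rewrite mdegD mdeg_delta leq_addr.
pose f c := (delta u + place (wperm u)^-1 c)%MM.
rewrite /npart -!size_filter -[RHS](size_map f); apply: perm_size.
apply: uniq_perm; rewrite ?filter_uniq ?uniq_monos //.
  rewrite map_inj_uniq ?filter_uniq ?uniq_monos //.
  by apply: inj_comp (can_inj (placeK _)); apply: addmI.
move=> b; rewrite mem_filter mem_monos; apply/andP/mapP => [[/eqP bu /eqP b_i]|[c]].
  exists (epart d b); last by rewrite /f -bu epartK.
  rewrite mem_filter ispart_epart mem_monos -b_i -[b in X in _ == X](epartK d).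
  by rewrite mdegD mdeg_delta bu mdeg_place addKn eqxx.
rewrite mem_filter mem_monos => /andP[c_part /eqP c_i] ->.
by rewrite eword_delta_add // mdegD mdeg_delta mdeg_place c_i subnKC ?eqxx.
Qed.

Definition lexle (x y : nat * nat) := (y.1 < x.1)%N || (x.1 == y.1) && (y.2 <= x.2)%N.

Definition lexsorted a b :=
  [forall p : 'I_n, forall q : 'I_n, (q == p.+1 :> nat) ==> lexle (a p, b p) (a q, b q)].

Lemma lexsortedP a b : reflect
  (forall p q, q = p.+1 :> nat -> lexle (a p, b p) (a q, b q)) (lexsorted a b).
Proof.
apply: (iffP forallP) => [ab p q /eqP eq_q|ab p].
  by have /forallP/(_ q)/implyP := ab p; apply.
by apply/forallP=> q; apply/implyP=> /eqP; apply: ab.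
Qed.

Lemma lexsorted_sorted a b :
  lexsorted a b -> sorted lexle [seq (a p, b p) | p <- enum 'I_n].
Proof.
move/lexsortedP=> ab; apply/(sortedP (0, 0)%N) => i.
rewrite size_map size_enum_ord => lt_i.
have lt_i' := ltnW lt_i; pose p := Ordinal lt_i'; pose q := Ordinal lt_i.
rewrite !(nth_map p _ (fun p => (a p, b p))) ?size_enum_ord //.
have -> : nth p (enum 'I_n) i = p by apply: ord_inj; rewrite nth_enum_ord.
have -> : nth p (enum 'I_n) i.+1 = q by apply: ord_inj; rewrite nth_enum_ord.
exact: ab.
Qed.

Lemma lexsorted_uniq a b s :
    lexsorted a b -> lexsorted (place s a) (place s b) ->
  place s a = a /\ place s b = b.
Proof.
move=> /lexsorted_sorted ab /lexsorted_sorted sab.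
have E : [seq (place s a p, place s b p) | p <- enum 'I_n] = [seq (a p, b p) | p <- enum 'I_n].
  apply: (sorted_eq _ _ sab ab).
  - by move=> y x z; rewrite /lexle; lia.
  - by move=> [x1 x2] [y1 y2]; rewrite /lexle /= => le_xy; congr pair; lia.
  under eq_map do rewrite !mnmE.
  rewrite (map_comp (fun p => (a p, b p))); apply/perm_map/uniq_perm.
  - by rewrite map_inj_uniq ?enum_uniq //; apply: perm_inj.
  - exact: enum_uniq.
  - by move=> p; rewrite mem_enum; apply/mapP; exists (s^-1%g p); rewrite ?mem_enum ?permKV.
have {}E p : (place s a p, place s b p) = (a p, b p).
  by move/eq_in_map: E; apply; rewrite mem_enum.
by split; apply/mnmP=> p; case: (E p).
Qed.

Lemma place_comp s t b : place s (place t b) = place (s * t) b.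
Proof. by apply/mnmP=> p; rewrite !mnmE permM. Qed.

Lemma lexsorted_exists a b : exists s, lexsorted (place s a) (place s b).
Proof.
pose t := (rkperm b)^-1%g; pose a1 := place t a; pose v := (rkperm a1)^-1%g.
exists (v * t)%g; rewrite -!place_comp -/a1; apply/lexsortedP => p q eq_q.
have : before a1 (v p) (v q) by rewrite before_rk !permKV eq_q.
have bt x y : before b (t x) (t y) = (x < y)%N by rewrite before_rk !permKV.
rewrite /lexle /= !mnmE; move: (bt (v p) (v q)); rewrite /before /a1 !mnmE.
lia.
Qed.

(** Sorting a pair has a unique result, so the sorting permutations form a coset of the
    stabilizer. *)
Lemma card_lexsorted a b :
  #|[set s | lexsorted (place s a) (place s b)]|
    = #|[set s | (place s a == a) && (place s b == b)]|.
Proof.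
have [s0 s0P] := lexsorted_exists a b.
rewrite -!sum1dep_card [RHS](reindex_inj (mulgI s0^-1%g)) /=.
apply: eq_bigl => s; rewrite -!place_comp.
have placeI c : place s0^-1 (place s c) = c <-> place s c = place s0 c.
  by split=> [/(canRL (placeK _)) //|->]; rewrite placeVK.
apply/idP/andP=> [sP|[/eqP/placeI -> /eqP/placeI ->] //].
have := @lexsorted_uniq _ _ (s * s0^-1)%g s0P.
rewrite !place_comp !mulgKV => /(_ sP)[sa sb].
by rewrite -!place_comp; split; apply/eqP/placeI.
Qed.

Lemma big_monos_place (R : Type) (idx : R) (op : Monoid.com_law idx) s i (F : 'X_{1..n} -> R) :
  \big[op/idx]_(b <- monos n i) F (place s b) = \big[op/idx]_(b <- monos n i) F b.
Proof. by rewrite -(big_map (place s) xpredT F); apply: perm_big; apply: perm_monos. Qed.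

(* Burnside's count of the orbits of pairs, [lexsorted] selecting one pair in each orbit *)
Lemma sum_stab_lexsorted (P : rel 'X_{1..n}) i j :
    (forall s a b, P (place s a) (place s b) = P a b) ->
  \sum_s \sum_(a <- monos n i) \sum_(b <- monos n j)
     (P a b && ((place s a == a) && (place s b == b)) : nat)
  = (n`! * \sum_(a <- monos n i) \sum_(b <- monos n j) (P a b && lexsorted a b : nat))%N.
Proof.
move=> Pinv; rewrite -card_Sn -sum_nat_const.
rewrite [RHS](eq_big xpredT (fun s => \sum_(a <- monos n i) \sum_(b <- monos n j)
    (P a b && lexsorted (place s a) (place s b) : nat)))%N //; last first.
  move=> s _; rewrite -(big_monos_place _ s); apply: eq_bigr => a _.
  by rewrite -(big_monos_place _ s); apply: eq_bigr => b _; rewrite Pinv.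
rewrite exchange_big [RHS]exchange_big; apply: eq_bigr => a _.
rewrite exchange_big [RHS]exchange_big; apply: eq_bigr => b _ /=.
case: (P a b); last by rewrite !big1.
by rewrite /= -!big_mkcond !sum1dep_card card_lexsorted.
Qed.

(** The action of sigma on W when [sigma zeta = zeta ^+ r], see [gal_wreath_twist]. *)
Definition twist r u : wreath d.+1 n := Wreath (wperm u) [ffun p => inZp (r * wcol u p)].

(** The two factors on the right are the equalities of colours and of permutations. For the latter,
    the index tie-break in [before a], read through [rkperm b], becomes the comparison of the
    entries of b, so lexicographic sorting says that [rkperm a] is the inverse of [rkperm b]. *)
Lemma eword_twist r a b :
  (eword d b == twist r (eword d a)^-1%g)
    = [forall p, d.+1 %| b p + r * place (rkperm b) a p] && lexsorted (place (rkperm b) a) b.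
Proof.
set t := rkperm b; have sortE : lexsorted (place t a) b = (rkperm a == t^-1%g).
  have bt p q : q = p.+1 :> nat ->
      lexle (place t a p, b p) (place t a q, b q) = before a (t p) (t q).
    move=> eq_q; rewrite /lexle /before !placeE /= -before_rk /before eq_q; lia.
  apply/lexsortedP/eqP => [ab|at1 p q eq_q].
    by apply: rkperm_uniq => p q eq_q; rewrite -bt ?ab.
  by rewrite bt // before_rk at1 !permK eq_q.
rewrite sortE andbC.
have wreathE (s s' : 'S_n) (c c' : {ffun 'I_n -> 'I_d.+1}) :
    (Wreath s c == Wreath s' c') = (s == s') && (c == c').
  by apply/eqP/andP=> [[-> ->]|[/eqP -> /eqP ->]].
rewrite wreathE /= invgK eq_sym -/t; case: eqP => //= at1.
have negK x : (r * ((d.+1 - x %% d.+1) %% d.+1) + r * x = 0 %[mod d.+1])%N.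
  rewrite -mulnDr -modnMmr modnDml -(modnDmr _ x) subnK ?modnn ?muln0 //.
  by rewrite ltnW // ltn_mod.
have colE p : (b p == r * wcol (winv (eword d a)) (t p) %[mod d.+1])
              = (d.+1 %| b p + r * place t a p)%N.
  by rewrite -(eqn_modDr (r * a (t p))) placeE !ffunE /= at1 invgK permK negK mod0n.
apply/eqP/forallP => [/ffunP col p | col].
  by have /(congr1 val) := col (t p); rewrite -colE !ffunE /= !permK => ->; rewrite invgK permK.
apply/ffunP=> p; apply: val_inj; have := col (t^-1%g p).
by rewrite -colE !permKV !ffunE /= invgK => /eqP.
Qed.

End Counting.

(** * Raising the largest entries of an exponent *)

Section Raising.
Variables d n : nat.
Implicit Types (b c : 'X_{1..n}) (i j p q : 'I_n) (k : nat) (s : 'S_n) (u : wreath d.+1 n).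
Implicit Types h : {set 'I_n}.

Lemma ispart_antimono c : ispart d c -> forall p q, (p <= q)%N -> (c q <= c p)%N.
Proof.
case/ispartP=> _ mono p q; rewrite leq_eqVlt => /orP[/eqP/val_inj -> //|].
apply: (consecutive_trans (r := fun p q => c q <= c p)%N) => // x y z xy /leq_trans.
exact.
Qed.

Lemma epart_delta_add u c : ispart d c -> epart d (delta u + place (wperm u)^-1 c) = c.
Proof. by move=> c_part; rewrite /epart eword_delta_add // addmC addmK placeK. Qed.

Definition topset k b : {set 'I_n} := [set i | (rk b i < k)%N].

Lemma card_topset k b : (k <= n)%N -> #|topset k b| = k.
Proof.
move=> le_kn; rewrite -[RHS](card_ord_lt le_kn) -(card_imset _ (@perm_inj _ (rkperm b))).
apply: eq_card => p; rewrite !inE -[p](permKV (rkperm b)) (mem_imset _ _ perm_inj) inE.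
by rewrite [in RHS]permE.
Qed.

Definition raise k b := (b + mesym1 (topset k b) *+ d.+1)%MM.

Lemma mdeg_raise k b : (k <= n)%N -> mdeg (raise k b) = (mdeg b + d.+1 * k)%N.
Proof. by move=> le_kn; rewrite mdegD mdegMn mdeg_mesym1 card_topset // mulnC. Qed.

Definition column k : 'X_{1..n} := [multinom d.+1 * (p < k) | p < n].

Lemma columnE k p : column k p = (d.+1 * (p < k))%N.
Proof. exact: mnmE. Qed.

(** Adding D to the first k variables changes neither their order nor the residues: it only adds a
    column of length k to the partition. Hence [raise] fixes the word. *)
Lemma raiseE k b : raise k b
  = (delta (eword d b) + place (wperm (eword d b))^-1 (epart d b + column k))%MM.
Proof.
rewrite /raise -{1}[b](epartK d) -addmA; congr (_ + _)%MM; apply/mnmP=> i.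
rewrite !mnmDE !placeE mnmDE mulmnE !mnmE inE /= invgK; congr (_ + _)%N.
by rewrite mulnC permE.
Qed.

Lemma ispart_column k c : ispart d c -> ispart d (c + column k).
Proof.
case/ispartP=> dv mono; apply/ispartP; split=> [p|p q eq_q].
  by rewrite mnmDE mnmE dvdn_addr ?dvdn_mulr.
rewrite !mnmDE !mnmE leq_add ?mono // leq_mul2l eq_q.
by case: ltnP => //= /ltnW ->.
Qed.

Lemma eword_raise k b : eword d (raise k b) = eword d b.
Proof. by rewrite raiseE eword_delta_add // ispart_column // ispart_epart. Qed.

Lemma epart_raise k b : epart d (raise k b) = (epart d b + column k)%MM.
Proof. by rewrite raiseE epart_delta_add // ispart_column // ispart_epart. Qed.

Lemma raise_inj k : injective (raise k).
Proof.
move=> b c eq_bc; have := epart_raise k b; have := eword_raise k b.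
rewrite eq_bc eword_raise epart_raise => eq_w /addIm eq_p.
by rewrite -[b](epartK d) -[c](epartK d) eq_w eq_p.
Qed.

Lemma raise_neq_delta k b u : (0 < k <= n)%N -> raise k b != delta u.
Proof.
case/andP=> k_gt0 le_kn; apply/eqP => E; have := eword_raise k b; rewrite {1}E eword_delta => Eu.
have /eqP := congr1 (@mdeg n) E; rewrite mdeg_raise // Eu mdeg_delta -{1}[b](epartK d).
by rewrite mdegD mdeg_delta; lia.
Qed.

(** If the partition part of b is not empty, one of its columns can be removed. *)
Lemma raise_case b :
  b = delta (eword d b) \/ exists k b', (0 < k <= n)%N /\ b = raise k b'.
Proof.
set u := eword d b; set c := epart d b; have c_part : ispart d c := ispart_epart d b.
have [c0|] := eqVneq c 0%MM.
  left; rewrite -[LHS](epartK d) -/c c0; apply/mnmP=> i.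
  by rewrite mnmDE placeE mnm0E addn0.
case/mnm_gt0_exists=> p0 p0_gt0.
(* p is the last position with a nonzero part, so the column of length [p.+1] fits inside c. *)
case: (@arg_maxnP _ p0 (fun p => 0 < c p)%N val p0_gt0) => p p_gt0 p_max.
have [dv _] := ispartP _ _ c_part.
have colP i : (column p.+1 i <= c i)%N.
  rewrite columnE ltnS; case: (leqP i p) => [le_ip|_]; last by rewrite /= muln0.
  have := ispart_antimono c_part le_ip; rewrite muln1 => le_c.
  by rewrite dvdn_leq // (leq_trans p_gt0).
have c_col : (c = (c - column p.+1) + column p.+1)%MM.
  by rewrite submK //; apply/mnm_lepP.
have c'_part : ispart d (c - column p.+1).
  apply/ispartP; split=> [i|i j eq_j]; rewrite !mnmBE.
    by rewrite dvdn_sub // columnE dvdn_mulr.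
  have [le_jp|lt_pj] := leqP j p.
    rewrite !columnE !ltnS le_jp (_ : (i <= p)%N) ?leq_sub2r ?(ispart_antimono c_part) ?eq_j //.
    by move: le_jp; rewrite eq_j => /ltnW.
  suff -> : c j = 0%N by rewrite sub0n.
  by apply/eqP; rewrite -leqn0 leqNgt; apply: contraTN lt_pj => /p_max /=; rewrite leqNgt.
right; exists p.+1, (delta u + place (wperm u)^-1 (c - column p.+1))%MM.
rewrite ltn_ord raiseE eword_delta_add // epart_delta_add // -c_col; split=> //.
by rewrite -[LHS](epartK d).
Qed.

Lemma raise_ind (P : 'X_{1..n} -> Prop) :
    (forall u, P (delta u)) -> (forall k b, (0 < k <= n)%N -> P b -> P (raise k b)) ->
  forall b, P b.
Proof.
move=> Pd Pr b; move: {2}(mdeg b) (leqnn (mdeg b)) => m; elim: m b => [|m IHm] b le_m.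
all: case: (raise_case b) => [->|[k [b' [k_n Eb]]]]; first exact: Pd.
all: have := k_n; rewrite {1}Eb => /andP[k_gt0 k_le]; rewrite Eb mdeg_raise // in le_m *.
  by lia.
by apply: Pr => //; apply: IHm; lia.
Qed.

(* For sets [h] of a given size, the increase of the energy when [d.+1] is      *)
(* added to the entries in [h] is largest exactly when [h] consists of the      *)
(* entries that come first in the order [before b].                             *)
Definition energy b : nat := \sum_i (n * b i ^ 2 + 2 * (n - i) * b i).

Lemma energy_lt k b h : (k <= n)%N -> #|h| = k -> h != topset k b ->
  (energy (b + mesym1 h *+ d.+1) < energy (raise k b))%N.
Proof.
move=> le_kn card_h neq_h.
(* The gain in energy when D is added at i. Since [n - i] lies between 1 and n, [n * b i + (n - i)]
   orders the variables exactly as [before b] does. *)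
pose f i := (2 * d.+1 * (n * b i + (n - i)) + n * d.+1 ^ 2)%N.
have energyE h' : energy (b + mesym1 h' *+ d.+1) = (energy b + \sum_(i in h') f i)%N.
  rewrite /energy [X in (_ + X)%N]big_mkcond -big_split; apply: eq_bigr => i _ /=.
  rewrite mnmDE mulmnE mnmE /f; case: (i \in h') => /=; last by rewrite !mul0n !addn0.
  by rewrite mul1n; ring.
rewrite /raise !energyE ltn_add2l; set t := topset k b.
have card_t : #|t| = k by rewrite card_topset.
rewrite (big_setID t) [X in (_ < X)%N](big_setID h) /= setIC ltn_add2l.
have eq_card : #|h :\: t| = #|t :\: h|.
  by apply/eqP; rewrite -(eqn_add2l #|h :&: t|) cardsID setIC cardsID card_h card_t.
have [x0 x0_ht] : exists x, x \in h :\: t.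
  apply/set0Pn; apply: contraNneq neq_h => ht0; rewrite eqEcard card_t card_h leqnn andbT.
  by rewrite -setD_eq0 ht0.
pose x := [arg max_(i > x0 in h :\: t) f i].
have [x_ht x_max] : x \in h :\: t /\ forall i, i \in h :\: t -> (f i <= f x)%N.
  by rewrite /x; case: arg_maxnP.
have f_lt y : y \in t :\: h -> (f x < f y)%N.
  move: x_ht; rewrite !inE -leqNgt => /andP[x_k _] /andP[_ y_k].
  have : before b y x by rewrite before_rk !permE /= (leq_trans y_k).
  rewrite /before /f; have := ltn_ord x; have := ltn_ord y.
  move=> y_n x_n /orP[lt_b|/andP[/eqP -> lt_yx]]; rewrite ltn_add2r ltn_pmul2l //; last lia.
  by have := leq_mul2l n (b x).+1 (b y); rewrite lt_b orbT mulnS; lia.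
apply: (@leq_ltn_trans (#|t :\: h| * f x)%N).
  by rewrite -eq_card -sum_nat_const; apply: leq_sum.
rewrite -sum_nat_const; apply: (@leq_trans (\sum_(i in t :\: h) (f x).+1)%N).
  rewrite !sum_nat_const ltn_pmul2l // -eq_card.
  by apply/card_gt0P; exists x0.
exact: leq_sum.
Qed.

End Raising.

(** * Linear maps given by their values on monomials *)

HB.lock Definition mlin (R : comNzRingType) n (V : lmodType R) (f : 'X_{1..n} -> V)
    (p : {mpoly R[n]}) : V :=
  (\sum_(m <- msupp p) p@_m *: f m)%R.

Section LinearExtension.
Variables (R : comNzRingType) (n : nat) (V : lmodType R).
Implicit Types (f g : 'X_{1..n} -> V) (p q : {mpoly R[n]}).
Local Open Scope ring_scope.

Lemma mlinwE f p k : (msize p <= k)%N ->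
  mlin f p = \sum_(m : 'X_{1..n < k}) p@_m *: f m.
Proof.
move=> le_pk; pose I : subFinType _ := 'X_{1..n < k}.
rewrite mlin.unlock (big_mksub I) //=; first last.
- by move=> m /msize_mdeg_lt /leq_trans; apply.
- exact: msupp_uniq.
by rewrite big_rmcond //= => m /memN_msupp_eq0 ->; rewrite scale0r.
Qed.

Lemma mlin_linear f : linear (mlin f).
Proof.
move=> c p q; pose k := maxn (msize (c *: p + q)) (maxn (msize p) (msize q)).
rewrite !(@mlinwE _ _ k) ?leq_max ?leqnn ?orbT // scaler_sumr -big_split.
by apply: eq_bigr => m _ /=; rewrite mcoeffD mcoeffZ scalerDl scalerA.
Qed.
HB.instance Definition _ f :=
  GRing.isLinear.Build R {mpoly R[n]} V _ (mlin f) (mlin_linear f).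

Lemma mlinX f m : mlin f 'X_[m] = f m.
Proof. by rewrite mlin.unlock msuppX big_seq1 mcoeffX eqxx scale1r. Qed.

Lemma mpoly_linear_ext (f g : {linear {mpoly R[n]} -> V}) :
  (forall m, f 'X_[m] = g 'X_[m]) -> f =1 g.
Proof.
move=> eq_fg p; rewrite [p]mpolyE !linear_sum; apply: eq_bigr => m _.
by rewrite !linearZ /= eq_fg.
Qed.

End LinearExtension.

Local Open Scope ring_scope.

(** * The descent basis *)

Section DescentBasis.
Variables (R : comNzRingType) (d n : nat).
Local Notation S := {mpoly R[n]}.
Implicit Types (b c m : 'X_{1..n}) (p q : S) (k i : nat) (u : wreath d.+1 n).

Definition theta k : S := \sum_(h : {set 'I_n} | #|h| == k) 'X_[mesym1 h *+ d.+1].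

Lemma theta_homog k : theta k \is (d.+1 * k).-homog.
Proof.
apply: rpred_sum => h /eqP card_h.
by rewrite dhomogX /= mdegMn mdeg_mesym1 card_h mulnC.
Qed.

Lemma thetaX k b : (k <= n)%N -> theta k * 'X_[b] =
  'X_[raise d k b] +
  \sum_(h : {set 'I_n} | (#|h| == k) && (h != topset k b)) 'X_[b + mesym1 h *+ d.+1].
Proof.
move=> le_kn; rewrite mulrC mulr_sumr (bigD1 (topset k b)) /=; last first.
  by rewrite card_topset.
by rewrite -mpolyXD; congr (_ + _); apply: eq_bigr => h _; rewrite mpolyXD.
Qed.

Definition mnext c (p : 'I_n) : nat := if insub p.+1 is Some q then c q else 0.

(** [theta p.+1] occurs once for each column of length [p.+1] of the partition c / D; [mnext] takes
    0 as the part after the last. *)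
Definition theta_part c : S :=
  \prod_(p < n) theta p.+1 ^+ ((c p - mnext c p) %/ d.+1).

Lemma theta_part0 : theta_part 0%MM = 1.
Proof. by rewrite /theta_part big1 // => p _; rewrite mnm0E sub0n div0n expr0. Qed.

Lemma theta_part_column k c : (0 < k <= n)%N -> ispart d c ->
  theta_part (c + column d n k)%MM = theta k * theta_part c.
Proof.
case: k => // k /andP[_ lt_kn] /ispartP[dv mono]; pose p0 := Ordinal lt_kn.
have next_le (p : 'I_n) : (mnext c p <= c p)%N.
  by rewrite /mnext; case: insubP => // q _ /mono.
have next_col (p : 'I_n) : (mnext (c + column d n k.+1) p
    = mnext c p + d.+1 * (p < k))%N.
  rewrite /mnext; case: insubP => [q _ eq_q|]; first by rewrite mnmDE columnE eq_q ltnS.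
  by rewrite -leqNgt => le_n; rewrite (_ : (p < k)%N = false) ?muln0 //; lia.
have next_dvd (p : 'I_n) : (d.+1 %| c p - mnext c p)%N.
  by rewrite dvdn_sub // /mnext; case: insubP.
rewrite /theta_part (bigD1 p0) // [in RHS](bigD1 p0) // mulrA; congr (_ * _).
  rewrite next_col mnmDE columnE /= ltnSn ltnn muln1 muln0 addn0 -addnBAC //.
  by rewrite divnDl // divnn addn1 exprS.
apply: eq_bigr => p /negbTE; rewrite -val_eqE /= => neq_pk.
rewrite next_col mnmDE columnE ltnS (leq_eqVlt p) neq_pk /=.
by rewrite subnDr.
Qed.

Definition dmon b : S := 'X_[delta (eword d b)] * theta_part (epart d b).

Lemma dmon_delta u : dmon (delta u) = 'X_[delta u].
Proof.
rewrite /dmon /epart eword_delta (_ : place _ _ = 0%MM) ?theta_part0 ?mulr1 //.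
by apply/mnmP=> i; rewrite placeE mnmBE subnn mnm0E.
Qed.

Lemma dmon_raise k b : (0 < k <= n)%N -> dmon (raise d k b) = theta k * dmon b.
Proof.
move=> k_n; rewrite /dmon eword_raise epart_raise theta_part_column ?ispart_epart //.
by rewrite mulrCA.
Qed.

Lemma dmon_homog b : dmon b \is (mdeg b).-homog.
Proof.
elim/(@raise_ind d n): b => [u|k b k_n IHb]; first by rewrite dmon_delta dhomogX.
rewrite dmon_raise // mdeg_raise; last by case/andP: k_n.
rewrite (addnC (mdeg b)); apply: dhomogM IHb; exact: theta_homog.
Qed.

Lemma mlin_homog (f : 'X_{1..n} -> S) i p :
  (forall m, f m \is (mdeg m).-homog) -> p \is i.-homog -> mlin f p \is i.-homog.
Proof.
move=> f_hom p_hom; rewrite mlin.unlock big_seq rpred_sum // => m m_p.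
by rewrite rpredZ // -(dhomog_mf p_hom m_p).
Qed.

Definition dlin : S -> S := mlin dmon.
HB.instance Definition _ := GRing.Linear.on dlin.
Definition raising k : S -> S := mlin (fun m => 'X_[raise d k m]).
HB.instance Definition _ k := GRing.Linear.on (raising k).

Lemma dlin_homog i p : p \is i.-homog -> dlin p \is i.-homog.
Proof. exact/mlin_homog/dmon_homog. Qed.

Lemma dlin_raising k p : (0 < k <= n)%N -> dlin (raising k p) = theta k * dlin p.
Proof.
move=> k_n; rewrite [p]mpolyE !linear_sum mulr_sumr. apply: eq_bigr => m _.
by rewrite !linearZ /= -scalerAr /raising /dlin !mlinX dmon_raise.
Qed.

Lemma mcoeff_raising k p m : (raising k p)@_(raise d k m) = p@_m.
Proof.
rewrite [p in LHS]mpolyE !linear_sum /= [p in RHS]mpolyE linear_sum.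
apply: eq_bigr => m' _; rewrite !linearZ /= /raising mlinX !mcoeffX.
by rewrite (inj_eq (@raise_inj d n k)).
Qed.

(** Induction on the degree, then on the energy. If b raises b', then [theta k * 'X_[b']] is in the
    image by the smaller degree of b', and by [thetaX] it equals ['X_[b]] plus monomials of the same
    degree and, by [energy_lt], of smaller energy. *)
Lemma dlin_surjX b : exists p, dlin p == 'X_[b].
Proof.
move: {2}(mdeg b) (erefl (mdeg b)) => D; elim/ltn_ind: D b => D IHD b.
move: {2}(energy b) (erefl (energy b)) => e; elim/ltn_ind: e b => e IHe b b_e b_D.
case: (raise_case d b) => [bE|[k [b' [k_n bE]]]].
  by exists 'X_[b]; rewrite /dlin mlinX bE dmon_delta.
have /andP[k_gt0 le_kn] := k_n.
have b'_D : (mdeg b' < D)%N by rewrite -b_D bE mdeg_raise //; lia.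
have [p' /eqP p'E] := IHD _ b'_D b' erefl.
have /fin_all_exists[low lowE] (h : {set 'I_n}) : exists p,
    (#|h| == k) && (h != topset k b') -> dlin p = 'X_[b' + mesym1 h *+ d.+1].
  have [/andP[/eqP card_h h_top]|_] := boolP ((#|h| == k) && (h != topset k b')); last by exists 0.
  have e_lt : (energy (b' + mesym1 h *+ d.+1)%MM < e)%N by rewrite -b_e bE energy_lt.
  have [|p /eqP pE] := IHe _ e_lt (b' + mesym1 h *+ d.+1)%MM erefl; last by exists p.
  by rewrite mdegD mdegMn mdeg_mesym1 card_h -b_D bE mdeg_raise // mulnC.
exists (raising k p' - \sum_(h : {set 'I_n} | (#|h| == k) && (h != topset k b')) low h); apply/eqP.
rewrite linearB linear_sum /= dlin_raising // p'E thetaX // -bE.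
by rewrite (eq_bigr (fun h => 'X_[b' + mesym1 h *+ d.+1])) ?addrK.
Qed.

End DescentBasis.

(** * The inverse of the change of basis *)

Section DescentBasisInverse.
Variables (F : fieldType) (d n : nat).
Local Notation N := n.+1.
Local Notation S := {mpoly F[N]}.
Local Notation Sdeg i := (dhomog N F i).
Implicit Types (b m : 'X_{1..N}) (p q : S) (k i : nat) (u : wreath d.+1 N).
Local Notation dlin := (@dlin F d N).

Lemma dlin_surjX_homog b : exists p, (p \is (mdeg b).-homog) && (dlin p == 'X_[b]).
Proof.
have [p /eqP pE] := dlin_surjX F d b; exists (pihomog mdeg (mdeg b) p).
rewrite pihomogP /=; apply/eqP.
have homE i q : dlin (pihomog mdeg i q) = pihomog mdeg i (dlin q).
  apply: (@mpoly_linear_ext _ _ _ (dlin \o pihomog mdeg i) (pihomog mdeg i \o dlin)).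
  move=> m /=; rewrite pihomogX /dlin mlinX; case: eqP => [<-|/eqP m_i].
    by rewrite mlinX pihomog_dE ?dmon_homog.
  by rewrite linear0 (pihomog_ne0 m_i) ?dmon_homog.
by rewrite homE pE pihomogX eqxx.
Qed.

Definition dinv : S -> S := mlin (fun b => xchoose (dlin_surjX_homog b)).
HB.instance Definition _ := GRing.Linear.on dinv.

Lemma dinv_homog i p : p \is i.-homog -> dinv p \is i.-homog.
Proof.
by apply: mlin_homog => b; case/andP: (xchooseP (dlin_surjX_homog b)).
Qed.

Lemma dinvK : cancel dinv dlin.
Proof.
move=> p; apply: (@mpoly_linear_ext _ _ _ (dlin \o dinv) idfun) => m /=.
by rewrite /dinv mlinX; case/andP: (xchooseP (dlin_surjX_homog m)) => _ /eqP.
Qed.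

Definition homog_end (f : {linear S -> S})
    (f_hom : forall i p, p \is i.-homog -> f p \is i.-homog) i (p : Sdeg i) : Sdeg i :=
  DHomog (f_hom i p (dhomog_is_dhomog p)).

Lemma homog_end_linear f f_hom i : linear (@homog_end f f_hom i).
Proof. by move=> c p q; apply: val_inj; rewrite /= linearP. Qed.
HB.instance Definition _ f f_hom i :=
  GRing.isLinear.Build F (Sdeg i) (Sdeg i) _ (@homog_end f f_hom i) (@homog_end_linear f f_hom i).

(** In each degree [dlin] is a surjective endomorphism of a finite-dimensional space, hence
    injective. *)
Lemma dlinK : cancel dlin dinv.
Proof.
have dlin_hom i p : p \is i.-homog -> dlin p \is i.-homog by apply: dlin_homog.
have ker0 i p : p \is i.-homog -> dlin p = 0 -> p = 0.
  move=> p_hom p0; pose f := linfun (homog_end dlin_hom (i := i)).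
  have f_surj : (f @: fullv = fullv)%VS.
    apply/eqP; rewrite eqEsubv subvf; apply/subvP => q _; apply/memv_imgP.
    have q_hom := dinv_homog (dhomog_is_dhomog q).
    exists (DHomog q_hom); rewrite ?memvf // lfunE; apply: val_inj => /=.
    by rewrite dinvK.
  have := limg_ker_dim f fullv; rewrite f_surj capfv => /eqP.
  rewrite -[X in _ == X]add0n eqn_add2r dimv_eq0 => /eqP ker_f.
  have : DHomog p_hom \in lker f.
    by rewrite memv_ker lfunE /=; apply/eqP/val_inj.
  by rewrite ker_f memv0 => /eqP/(congr1 val).
move=> p; apply/eqP; rewrite -subr_eq0; apply/eqP.
apply: (@mpoly_linear_ext _ _ _ (dinv \o dlin \- idfun) \0) => m /=.
have m_hom : ('X_[m] : S) \is (mdeg m).-homog by rewrite dhomogX.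
apply: (ker0 (mdeg m)); last by rewrite linearB /= dinvK subrr.
by rewrite rpredB ?dinv_homog ?dlin_homog.
Qed.

Lemma dinv_theta k p : (0 < k <= N)%N -> dinv (theta F d N k * p) = raising d k (dinv p).
Proof. by move=> k_n; rewrite -[p in LHS]dinvK -dlin_raising // dlinK. Qed.

End DescentBasisInverse.

(** * The ideal of positive degree invariants *)

Lemma big_wreath (R : Type) (idx : R) (op : Monoid.com_law idx) d n (F : wreath d n -> R) :
  \big[op/idx]_w F w
    = \big[op/idx]_(s : 'S_n) \big[op/idx]_(c : {ffun 'I_n -> 'I_d}) F (Wreath s c).
Proof.
rewrite pair_big (reindex (@pair_wreath d n)) //.
by exists (@wreath_pair d n) => [[]|[]].
Qed.

Lemma sum_prim_root_expr (R : idomainType) d (z : R) (a : nat) : d.+1.-primitive_root z ->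
  \sum_(k < d.+1) z ^+ (k * a) = (d.+1 * (d.+1 %| a))%:R.
Proof.
move=> zP; under eq_bigr do rewrite mulnC exprM.
case: (boolP (d.+1 %| a)%N) => [a_dvd|a_ndvd].
  have /eqP za : z ^+ a == 1 by rewrite -(prim_order_dvd zP).
  rewrite (eq_bigr (fun=> 1)) => [|k _]; last by rewrite za expr1n.
  by rewrite sumr_const card_ord muln1.
rewrite muln0; apply: (mulfI (x := z ^+ a - 1)).
  by rewrite subr_eq0 -(prim_order_dvd zP).
by rewrite -subrX1 mulr0 exprAC (prim_expr_order zP) expr1n subrr.
Qed.

Lemma sum_col_expr (R : idomainType) d n (z : R) (a : 'I_n -> nat) : d.+1.-primitive_root z ->
  \sum_(c : {ffun 'I_n -> 'I_d.+1}) z ^+ (\sum_k c k * a k)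
    = (d.+1 ^ n * [forall k, d.+1 %| a k]%N)%:R.
Proof.
move=> zP; under eq_bigr do rewrite -prodrXr.
rewrite -(bigA_distr_bigA (fun k (x : 'I_d.+1) => z ^+ (x * a k))) /=.
under eq_bigr do rewrite (sum_prim_root_expr _ zP).
rewrite -natr_prod big_split /= prod_nat_const card_ord; congr (_ * _)%:R.
case: forallP => [dv|ndv]; first by rewrite big1 // => k _; rewrite dv.
have [k] : exists k, ~~ (d.+1 %| a k)%N.
  by apply/existsP; rewrite -negb_forall; apply/negP => /forallP.
by move/negbTE=> k_ndv; rewrite (bigD1 k) //= k_ndv.
Qed.

Section Action.
Variables (d n : nat) (omega : algC).
Hypothesis omegaP : d.+1.-primitive_root omega.
Local Notation N := n.+1.
Local Notation W := (wreath d.+1 N).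
Local Notation S := {mpoly algC[N]}.
Implicit Types (w v : W) (b m : 'X_{1..N}) (p q g : S) (k i : nat) (u : wreath d.+1 N).
Local Notation pact := (@pact d n omega).
Local Notation theta := (theta algC d N).

(** Stated for the inverse because [pact w] substitutes the matrix of the inverse of w. *)
Lemma pactVX w b : pact w^-1%g 'X_[b]
  = omega ^+ (\sum_k wcol w k * b (wperm w k))%N *: 'X_[place (wperm w) b].
Proof.
rewrite pactX (reindex_inj (@perm_inj _ (wperm w))) /=.
have pXU (k : 'I_N) : pact w^-1%g 'X_(wperm w k) = omega ^+ wcol w k *: 'X_k.
  rewrite pactXU invgK (bigD1 k) //= mxE eqxx big1 ?addr0 // => j neq_jk.
  by rewrite mxE (inj_eq perm_inj) eq_sym (negbTE neq_jk) scale0r.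
under eq_bigr do rewrite pXU exprZn -exprM.
rewrite scaler_prod prodrXr mpolyXE_id; congr (_ *: _).
by apply: eq_bigr => k _; rewrite placeE.
Qed.

Lemma pact_theta w k : pact w (theta k) = theta k.
Proof.
rewrite -[w]invgK; move: (w^-1)%g => {}w.
rewrite linear_sum /= (reindex_inj (imset_inj (@perm_inj _ (wperm w)))) /=.
apply: eq_big => [h|h _]; first by rewrite card_imset //; apply: perm_inj.
rewrite pactVX (_ : omega ^+ _ = 1) ?scale1r.
  congr 'X_[_]; apply/mnmP=> i.
  by rewrite placeE !mulmnE !mnmE (mem_imset _ _ perm_inj).
apply/eqP; rewrite -(prim_order_dvd omegaP) dvdn_sum // => j _.
by rewrite mulmnE mulnA dvdn_mull.
Qed.

Definition theta_ideal p : Prop := exists g : 'I_N -> S, p = \sum_(k < N) theta k.+1 * g k.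

Lemma theta_ideal_sum I (r : seq I) (P : pred I) (F : I -> S) :
  (forall j, P j -> theta_ideal (F j)) -> theta_ideal (\sum_(j <- r | P j) F j).
Proof.
move=> PF; elim/big_rec: _ => [|j p /PF[f ->] [g ->]].
  by exists (fun=> 0); rewrite big1 // => k _; rewrite mulr0.
exists (fun x => f x + g x); rewrite -big_split; apply: eq_bigr => k _.
by rewrite mulrDr.
Qed.

Lemma theta_idealM p q : theta_ideal q -> theta_ideal (p * q).
Proof.
case=> g ->; exists (fun x => p * g x); rewrite mulr_sumr.
by apply: eq_bigr => k _; rewrite mulrCA.
Qed.

Lemma theta_idealZ c q : theta_ideal q -> theta_ideal (c *: q).
Proof. by rewrite -mul_mpolyC; apply: theta_idealM. Qed.

Lemma theta_ideal_theta k g : (0 < k <= N)%N -> theta_ideal (theta k * g).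
Proof.
case: k => // k /andP[_ lt_kN]; exists (fun j => if j == Ordinal lt_kN then g else 0).
rewrite (bigD1 (Ordinal lt_kN)) //= eqxx big1 ?addr0 // => j /negbTE ->.
exact: mulr0.
Qed.

Lemma theta_coef0 k : (0 < k)%N -> (theta k)@_0%MM = 0.
Proof.
move=> k_gt0; rewrite (dhomog_nemf_coeff (theta_homog _ _ _ _)) //= mdeg0.
by rewrite eq_sym muln_eq0 -lt0n.
Qed.

Lemma theta_ideal_coef0 p : theta_ideal p -> p@_0%MM = 0.
Proof.
case=> g ->; rewrite linear_sum big1 // => k _ /=.
by rewrite [LHS]rmorphM /= theta_coef0 // mul0r.
Qed.

Lemma theta_ideal_coinv p : theta_ideal p -> coinv_ideal d omega p.
Proof.
case=> g ->; apply: coinv_ideal_sum => k _; rewrite mulrC.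
apply: coinv_idealM; apply: mem_coinv_ideal; first by apply/pinvariantP => w; apply: pact_theta.
exact: theta_coef0.
Qed.

(** The orbit sum of m is a polynomial t in the elementary symmetric polynomials; substituting the
    D-th powers of the variables turns these into the [theta k]. *)
Lemma theta_ideal_orbit m : m != 0%MM -> theta_ideal (\sum_s 'X_[place s m *+ d.+1]).
Proof.
move=> mN0; pose g : S := \sum_(s : 'S_N) 'X_[place s m].
have g_sym : g \is mpoly.symmetric.
  apply/issymP=> t; rewrite /g linear_sum /= [RHS](reindex_inj (mulgI t^-1%g)).
  by apply: eq_bigr => s _; rewrite msymX -place_comp.
have [t [gE _]] := sym_fundamental g_sym.
pose P : N.-tuple S := [tuple 'X_i ^+ d.+1 | i < N].
have XP a : 'X_[a] \mPo P = 'X_[a *+ d.+1] :> S.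
  rewrite comp_mpolyX mpolyXE_id; apply: eq_bigr => i _.
  by rewrite tnth_mktuple -exprM mulnC mulmnE mulnC.
have mesymP k : mesym N algC k \mPo P = theta k.
  by rewrite mesymE linear_sum; apply: eq_bigr => h _; rewrite /= XP.
pose E (a : 'X_{1..N}) : S := \prod_(i < N) theta i.+1 ^+ a i.
have orbE : \sum_s 'X_[place s m *+ d.+1] = \sum_(a <- msupp t) t@_a *: E a.
  transitivity (g \mPo P); first by rewrite /g linear_sum; apply: eq_bigr => s _; rewrite /= XP.
  rewrite -gE (comp_mpolyEX t) linear_sum; apply: eq_bigr => a _; rewrite linearZ /=.
  congr (_ *: _); rewrite comp_mpolyX rmorph_prod; apply: eq_bigr => i _.
  by rewrite rmorphXn /= tnth_mktuple mesymP.
have E_ideal a : a != 0%MM -> theta_ideal (E a).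
  case/mnm_gt0_exists=> i ai.
  rewrite /E (bigD1 i) //= -(prednK ai) exprS -mulrA.
  by apply: theta_ideal_theta; rewrite /= ltn_ord.
(* Compare constant terms: the orbit sum has none as m is nonzero, nor has any [E a] with a
   nonzero. *)
have t0 : t@_0%MM = 0.
  have t_supp : 0%MM \notin msupp t -> t@_0%MM = 0 by apply: memN_msupp_eq0.
  case: (boolP (0%MM \in msupp t)) => // t0_supp.
  have := congr1 (mcoeff 0%MM) orbE; rewrite (bigD1_seq 0%MM) ?msupp_uniq //= linearD /=.
  rewrite [X in _ + X]theta_ideal_coef0; last first.
    by apply: theta_ideal_sum => a aN0; apply/theta_idealZ/E_ideal.
  have -> : E 0%MM = 1 by rewrite /E big1 // => i _; rewrite mnm0E expr0.
  rewrite linearZ /= mcoeff1 eqxx mulr1 addr0 => <-; rewrite linear_sum big1 // => s _ /=.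
  rewrite mcoeffX; apply/eqP; rewrite pnatr_eq0 eqb0; apply: contraNneq mN0 => m0.
  by rewrite -mdeg_eq0 -(mdeg_place s) -(eqn_pmul2r (ltn0Sn d)) -mdegMn m0 mdeg0.
rewrite orbE big_seq; apply: theta_ideal_sum => a a_t; apply/theta_idealZ/E_ideal.
by apply: contraTneq a_t => ->; rewrite mcoeff_msupp t0 eqxx.
Qed.

(** Summing over colours kills the monomial unless D divides all its exponents; what remains is an
    orbit sum in D-th powers. *)
Lemma sum_pact_theta_ideal m : m != 0%MM -> theta_ideal (\sum_w pact w 'X_[m]).
Proof.
move=> mN0; rewrite (reindex_inj invg_inj) /= big_wreath.
under eq_bigr => s _ do under eq_bigr => c _ do rewrite pactVX /=.
under eq_bigr => s _ do rewrite -scaler_suml (sum_col_expr (fun x => m (s x)) omegaP).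
have dvE (s : 'S_N) : [forall k, d.+1 %| m (s k)]%N = [forall k, d.+1 %| m k]%N.
  apply/forallP/forallP => dv k //.
  by rewrite -[k](permKV s).
under eq_bigr => s _ do rewrite dvE.
case: forallP => [dv|_]; last first.
  rewrite muln0 big1 => [|s _]; last by rewrite scale0r.
  by exists (fun=> 0); rewrite big1 // => k _; rewrite mulr0.
rewrite -scaler_sumr; apply: theta_idealZ.
pose m' := [multinom m i %/ d.+1 | i < N].
have mE : m = (m' *+ d.+1)%MM by apply/mnmP=> i; rewrite mulmnE mnmE divnK.
under eq_bigr => s _.
  rewrite (_ : place s m = place s m' *+ d.+1)%MM; last first.
    by apply/mnmP=> i; rewrite mE !(mulmnE, placeE).
  over.
apply: theta_ideal_orbit; apply: contraNneq mN0 => m'0.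
by rewrite mE m'0; apply/eqP/mnmP=> i; rewrite mulmnE mnm0E.
Qed.

(** An invariant is its own average over W, hence a combination of the orbit sums of its
    monomials. *)
Lemma coinv_theta_ideal p : coinv_ideal d omega p -> theta_ideal p.
Proof.
case=> s s_inv ->; rewrite big_seq; apply: theta_ideal_sum => -[g h] /(allP s_inv) /=.
case/andP=> /pinvariantP h_inv /eqP h0; apply: theta_idealM.
have W0 : #|{: W}|%:R != 0 :> algC.
  by rewrite pnatr_eq0 -lt0n; apply/card_gt0P; exists 1%g.
have -> : h = #|{: W}|%:R^-1 *: \sum_w pact w h.
  rewrite (eq_bigr (fun=> h)) => [|w _]; last by rewrite h_inv.
  by rewrite sumr_const -scaler_nat scalerA mulVf ?scale1r.
apply: theta_idealZ.
have -> : \sum_w pact w h = \sum_(m <- msupp h) h@_m *: \sum_w pact w 'X_[m].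
  rewrite (eq_bigr (fun w => \sum_(m <- msupp h) h@_m *: pact w 'X_[m])).
    by rewrite exchange_big; apply: eq_bigr => m _; rewrite scaler_sumr.
  move=> w _; rewrite {1}[h]mpolyE (linear_sum (pact w)).
  by apply: eq_bigr => m _; rewrite linearZ.
rewrite big_seq; apply: theta_ideal_sum => m m_h; apply/theta_idealZ/sum_pact_theta_ideal.
by apply: contraTneq m_h => ->; rewrite mcoeff_msupp h0 eqxx.
Qed.

End Action.

(** * Traces *)

Section FactmodTrace.
Variables (F : fieldType) (gT : finGroupType) (G : {group gT}) (n : nat).
Variables (rG : mx_representation F G n) (U : 'M[F]_n).
Hypothesis Umod : mxmodule rG U.

(** The hypotheses make Q a projection with kernel U. So [rG x *m Q] vanishes on U and induces on
    the quotient the action of x. *)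
Lemma mxtrace_factmod (Q : 'M[F]_n) x : x \in G ->
    U *m Q = 0 -> (1%:M - Q <= U)%MS ->
  \tr (factmod_repr Umod x) = \tr (rG x *m Q).
Proof.
move=> Gx UQ0 sQU; pose V := @val_factmod _ _ U _ 1%:M; pose I := in_factmod U 1%:M.
have UI0 m (A : 'M_(m, n)) : (A <= U)%MS -> A *m I = 0.
  by move=> sAU; rewrite -in_factmodE; apply/eqP; rewrite in_factmod_eq0.
have VI1 : V *m I = 1%:M by rewrite -in_factmodE val_factmodK.
have QI : Q *m I = I.
  by apply/eqP; rewrite -subr_eq0 -opprB oppr_eq0 -[X in X - _]mul1mx -mulmxBl UI0.
have PQ : I *m V *m Q = Q.
  apply/eqP; rewrite -subr_eq0 -opprB oppr_eq0 -[X in X - _]mul1mx -mulmxBl.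
  have /submxP[A ->] : (1%:M - I *m V <= U)%MS.
    by rewrite -in_factmod_eq0 in_factmodE -/I mulmxBl mul1mx -mulmxA VI1 mulmx1 subrr.
  by rewrite -mulmxA UQ0 mulmx0.
have PAQ : I *m V *m rG x *m Q = rG x *m Q.
  apply/eqP; rewrite -subr_eq0 -opprB oppr_eq0 -[X in X *m _ - _]mul1mx.
  rewrite -!mulmxBl -mulmxA.
  have /submxP[A EA] : ((1%:M - I *m V) *m rG x <= U)%MS.
    apply: submx_trans (mxmoduleP Umod x Gx); apply: submxMr.
    by rewrite -in_factmod_eq0 in_factmodE -/I mulmxBl mul1mx -mulmxA VI1 mulmx1 subrr.
  by rewrite mulmxA EA -mulmxA UQ0 mulmx0.
rewrite /factmod_repr /= /factmod_mx in_factmodE -/I -/V.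
rewrite -PAQ (_ : I *m V *m rG x *m Q = I *m (V *m rG x *m Q)); last by rewrite !mulmxA.
by rewrite [RHS]mxtrace_mulC -(mulmxA _ Q I) QI.
Qed.

End FactmodTrace.

Section HomogeneousTrace.
Variables (F : fieldType) (n : nat).
Local Notation N := n.+1.
Local Notation S := {mpoly F[N]}.
Local Notation Sdeg i := (dhomog N F i).
Implicit Types (p q : S) (i : nat) (b m : 'X_{1..N}).

Lemma homog_expand i p : p \is i.-homog -> p = \sum_(m <- monos N i) p@_m *: 'X_[m].
Proof.
move=> p_hom; apply/mpolyP=> m; rewrite linear_sum /=.
case: (boolP (m \in monos N i)) => [m_i|m_i].
  rewrite (bigD1_seq m) ?uniq_monos //= mcoeffZ mcoeffX eqxx mulr1 big1 ?addr0 //.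
  by move=> b /negbTE neq_bm; rewrite mcoeffZ mcoeffX neq_bm mulr0.
rewrite (dhomog_nemf_coeff p_hom) -?mem_monos // big_seq big1 // => b b_i.
rewrite mcoeffZ mcoeffX; case: eqP => [E|]; last by rewrite mulr0.
by rewrite -E b_i in m_i.
Qed.

Definition homog_trace i (f : S -> S) : F := \sum_(b <- monos N i) (f 'X_[b])@_b.

Lemma homog_traceC i (f g : {linear S -> S}) :
    (forall p, p \is i.-homog -> f p \is i.-homog) ->
    (forall p, p \is i.-homog -> g p \is i.-homog) ->
  homog_trace i (f \o g) = homog_trace i (g \o f).
Proof.
have expand (f1 g1 : {linear S -> S}) :
    (forall p, p \is i.-homog -> g1 p \is i.-homog) -> homog_trace i (f1 \o g1)
      = \sum_(b <- monos N i) \sum_(c <- monos N i) (g1 'X_[b])@_c * (f1 'X_[c])@_b.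
  move=> g_hom; rewrite /homog_trace !big_seq; apply: eq_bigr => b b_i /=.
  have b_hom : ('X_[b] : S) \is i.-homog by rewrite dhomogX /= -mem_monos.
  rewrite {1}(homog_expand (g_hom _ b_hom)) !linear_sum; apply: eq_bigr => c _.
  by rewrite !linearZ.
move=> f_hom g_hom; rewrite !expand // exchange_big; apply: eq_bigr => b _.
by apply: eq_bigr => c _; rewrite mulrC.
Qed.

Lemma mxtrace_mxof i (e : (\dim {:Sdeg i}).-tuple (Sdeg i)) (f : 'End(Sdeg i)) :
    basis_of {:Sdeg i} e ->
  \tr (mxof e e f) = \sum_(m <- monos N i) (f (indhomog i 'X_[m]) : S)@_m.
Proof.
move=> e_basis; pose X m := indhomog i ('X_[m] : S).
have XE m : m \in monos N i -> (X m : S) = 'X_[m].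
  by rewrite mem_monos => m_i; rewrite /X /indhomog insubdK // -topredE /= dhomogX.
have eE k : e`_k = \sum_(m <- monos N i) (e`_k : S)@_m *: X m.
  apply: val_inj; rewrite [LHS](homog_expand (dhomog_is_dhomog _)) linear_sum /=.
  by rewrite big_seq [RHS]big_seq; apply: eq_bigr => m m_i; rewrite XE.
transitivity (\sum_(k < _) \sum_(m <- monos N i) (e`_k : S)@_m * coord e k (f (X m))).
  rewrite /mxtrace; apply: eq_bigr => k _.
  rewrite !mxE /= vecof_delta {1}eE !linear_sum; apply: eq_bigr => m _.
  by rewrite !linearZ.
rewrite exchange_big big_seq [RHS]big_seq; apply: eq_bigr => m m_i /=.
rewrite [in RHS](coord_basis e_basis (memvf (f _))) !linear_sum; apply: eq_bigr => k _.
by rewrite !linearZ /= mulrC.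
Qed.

End HomogeneousTrace.

(** * Traces on the polynomial ring and on the coinvariant algebra *)

Section CoinvariantTrace.
Variables (d n : nat) (omega : algC).
Hypothesis omegaP : d.+1.-primitive_root omega.
Local Notation N := n.+1.
Local Notation W := (wreath d.+1 N).
Local Notation S := {mpoly algC[N]}.
Local Notation Sdeg i := (dhomog N algC i).
Implicit Types (w : W) (b m : 'X_{1..N}) (p q : S) (k i : nat) (u : W).
Local Notation pact := (@pact d n omega).
Local Notation theta := (theta algC d N).
Local Notation dmon := (dmon algC d).
Local Notation dlin := (@dlin algC d N).
Local Notation dinv := (@dinv algC d n).
Local Notation raising := (@raising algC d N).

(* The diagonal coefficient of [w] in the basis of the [dmon b]. *)
Definition tau w b : algC := (dinv (pact w (dmon b)))@_b.

(** The action of w commutes with multiplication by [theta k], which shifts the basis injectively.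
    Hence [tau w b] depends only on [eword b]. *)
Lemma tau_raise w k b : (0 < k <= N)%N -> tau w (raise d k b) = tau w b.
Proof.
move=> k_N; rewrite /tau dmon_raise // rmorphM /= pact_theta // dinv_theta //.
exact: mcoeff_raising.
Qed.

Lemma tau_delta w b : tau w b = tau w (delta (eword d b)).
Proof.
elim/(@raise_ind d N): b => [u|k b k_N IHb]; first by rewrite eword_delta.
by rewrite tau_raise // eword_raise.
Qed.

(** By cyclicity, the trace is that of [dinv \o pact w \o dlin], with diagonal entries [tau w b]. *)
Lemma homog_trace_pact w i : homog_trace i (pact w)
  = \sum_u tau w (delta u) *+ count (fun b => eword d b == u) (monos N i).
Proof.
transitivity (homog_trace i (dlin \o (dinv \o pact w))).
  by apply: eq_bigr => b _ /=; rewrite dinvK.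
rewrite (@homog_traceC _ _ _ dlin (dinv \o pact w)); first last.
- by move=> p p_hom /=; apply/dinv_homog/pact_homog.
- by move=> p; apply: dlin_homog.
rewrite /homog_trace (eq_bigr (fun b => tau w (delta (eword d b)))) => [|b _]; last first.
  by rewrite -tau_delta /= /tau /dlin mlinX.
under [RHS]eq_bigr => u _ do rewrite -sum1_count -sumrMnr big_mkcond /=.
rewrite exchange_big; apply: eq_bigr => b _ /=.
by rewrite -big_mkcond /= (eq_bigl _ _ (fun u => eq_sym _ u)) big_pred1_eq.
Qed.

Lemma homog_trace_pactV w i : homog_trace i (pact w^-1%g)
  = \sum_(b <- monos N i | place (wperm w) b == b) omega ^+ (\sum_k wcol w k * b k).
Proof.
rewrite [RHS]big_mkcond; apply: eq_bigr => b _; rewrite pactVX mcoeffZ mcoeffX.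
case: eqP => [bE|]; last by rewrite mulr0.
by rewrite mulr1; congr (_ ^+ _); apply: eq_bigr => k _; rewrite -{2}bE placeE.
Qed.

Definition dreduce : S -> S :=
  mlin (fun b => if b == delta (eword d b) then 'X_[b] else 0).
HB.instance Definition _ := GRing.Linear.on dreduce.

Lemma dreduce_homog i p : p \is i.-homog -> dreduce p \is i.-homog.
Proof.
apply: mlin_homog => b; case: ifP => _; first by rewrite dhomogX.
exact: dhomog0.
Qed.

Lemma dreduce_raising k p : (0 < k <= N)%N -> dreduce (raising k p) = 0.
Proof.
move=> k_N; rewrite [p]mpolyE (linear_sum (raising k)) (linear_sum dreduce) big1 // => b _.
rewrite !linearZ /= /raising /dreduce !mlinX (negbTE (raise_neq_delta _ _ k_N)).
exact: scaler0.
Qed.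

Lemma mcoeff_dreduce p b : (dreduce p)@_b = if b == delta (eword d b) then p@_b else 0.
Proof.
rewrite [p in LHS]mpolyE (linear_sum dreduce) linear_sum /= [p in RHS]mpolyE.
under eq_bigr do rewrite linearZ /= mcoeffZ /dreduce mlinX.
case: ifP => b_red; rewrite ?linear_sum /=.
  apply: eq_bigr => m _; rewrite mcoeffZ; case: ifP => // m_red.
  have /negbTE mb : m != b by apply: contraFneq m_red => ->.
  by rewrite mcoeff0 mcoeffX mb.
rewrite big1 // => m _; case: ifP => m_red; rewrite ?mcoeff0 ?mulr0 //.
have /negbTE mb : m != b by apply: contraFneq b_red => <-.
by rewrite mcoeffX mb mulr0.
Qed.

(** The projection onto the span of the descent monomials along the coinvariant ideal: [dreduce]
    discards the basis vectors divisible by some [theta k]. *)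
Definition coinv_proj : S -> S := dlin \o dreduce \o dinv.
HB.instance Definition _ := GRing.Linear.on coinv_proj.

Lemma coinv_proj_homog i p : p \is i.-homog -> coinv_proj p \is i.-homog.
Proof. by move=> p_hom; apply/dlin_homog/dreduce_homog/dinv_homog. Qed.

Lemma coinv_proj_ideal p : coinv_ideal d omega p -> coinv_proj p = 0.
Proof.
case/(coinv_theta_ideal omegaP)=> g ->; rewrite linear_sum big1 // => k _.
rewrite /= -[LHS]/(dlin (dreduce (dinv _))) dinv_theta ?ltn_ord // dreduce_raising ?ltn_ord //.
exact: linear0.
Qed.

Lemma coinv_proj_sub p : coinv_ideal d omega (p - coinv_proj p).
Proof.
have pE : p - coinv_proj p
    = \sum_(m <- msupp (dinv p)) (dinv p)@_m *: (dmon m - dlin (dreduce 'X_[m])).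
  rewrite -{1}[p](@dinvK _ d) /coinv_proj /= {1 2}[dinv p]mpolyE.
  rewrite (linear_sum dreduce) !(linear_sum dlin) -sumrB; apply: eq_bigr => m _.
  have linZ (f : {linear S -> S}) a x : f (a *: x) = a *: f x by rewrite linearZ.
  by rewrite (linZ dreduce) !(linZ dlin) -scalerBr; congr (_ *: (_ - _)); apply: mlinX.
apply: theta_ideal_coinv => //; rewrite pE; apply: theta_ideal_sum => m _.
apply: theta_idealZ; rewrite /dreduce mlinX.
case: (raise_case d m) => [mE|[k [b [k_N ->]]]].
  rewrite -mE eqxx /dlin mlinX subrr.
  by exists (fun=> 0); rewrite big1 // => k _; rewrite mulr0.
rewrite (negbTE (raise_neq_delta _ _ k_N)) linear0 subr0 dmon_raise //.
exact: theta_ideal_theta.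
Qed.

(** [mxtrace_factmod] for [coinv_proj]: after a cyclic permutation only the diagonal entries at the
    [delta u] of degree i survive. The inverse of w comes from the right action in [poly_mx]. *)
Lemma coinv_trace w i :
  cfRepr (coinv_repr n omegaP i) w = \sum_(u : W | fmaj u == i) tau w^-1%g (delta u).
Proof.
pose e := vbasis {:Sdeg i}; have e_basis : basis_of {:Sdeg i} e by apply: vbasisP.
pose U := coinv_ideal_deg d n omega i.
pose q := linfun (homog_end coinv_proj_homog (i := i)).
rewrite cfunE inE mulr1n.
rewrite (@mxtrace_factmod _ _ _ _ _ _ (coinv_ideal_module n omegaP i) (mxof e e q)) ?inE //.
- rewrite /= /poly_mx -mxof_comp // mxtrace_mxof //.
  transitivity (homog_trace i (dlin \o (dreduce \o (dinv \o pact w^-1%g)))).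
    rewrite /homog_trace big_seq [RHS]big_seq; apply: eq_bigr => m m_i.
    rewrite !lfunE /= !lfunE /=; congr (mcoeff m (coinv_proj (pact _ _))).
    by rewrite /indhomog insubdK // -topredE /= dhomogX /= -mem_monos.
  rewrite (@homog_traceC _ _ _ dlin (dreduce \o (dinv \o pact w^-1%g))); first last.
  + by move=> p p_hom /=; apply/dreduce_homog/dinv_homog/pact_homog.
  + by move=> p; apply: dlin_homog.
  rewrite /homog_trace.
  rewrite (eq_bigr (fun b => if b == delta (eword d b) then tau w^-1%g b else 0)); last first.
    by move=> b _; rewrite /= mcoeff_dreduce /tau /dlin mlinX.
  rewrite -big_mkcond -big_filter.
  have -> : \sum_(u : W | fmaj u == i) tau w^-1%g (delta u)
      = \sum_(b <- [seq delta u | u <- enum [pred u : W | fmaj u == i]]) tau w^-1%g b.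
    by rewrite big_map big_enum.
  apply/perm_big/uniq_perm; first by rewrite filter_uniq ?uniq_monos.
    by rewrite map_inj_uniq ?enum_uniq // => u v /(congr1 (@eword d N)); rewrite !eword_delta.
  move=> b; rewrite mem_filter mem_monos; apply/andP/mapP => [[/eqP b_red b_i]|[u]].
    by exists (eword d b) => //; rewrite mem_enum inE -mdeg_delta -b_red.
  by rewrite mem_enum inE => u_i ->; rewrite eword_delta mdeg_delta.
- apply/row_matrixP => k; rewrite row_mul mul_mxof row0 (_ : q _ = 0) ?linear0 //.
  rewrite lfunE; apply/val_inj/coinv_proj_ideal/(coinv_ideal_degP omegaP).
  by rewrite mem_vecof // row_sub.
apply/row_subP => k; rewrite rowE mulmxBr mulmx1 mul_mxof -mem_vecof // linearB /=.
rewrite rVofK // lfunE; apply/(coinv_ideal_degP omegaP).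
exact: coinv_proj_sub.
Qed.

End CoinvariantTrace.

(** * Coefficients of the bimahonian distribution *)

Section Convolution.
Variables (R : comNzRingType) (c : nat -> nat).
Implicit Types (X Y : nat -> R).

Definition conv X i : R := \sum_(k < i.+1) X (i - k)%N *+ c k.

Lemma eq_conv X Y : X =1 Y -> conv X =1 conv Y.
Proof. by move=> eqXY i; apply: eq_bigr => k _; rewrite eqXY. Qed.

(** A power series with constant term 1 can be cancelled. *)
Lemma conv_inj X Y : c 0 = 1%N -> conv X =1 conv Y -> X =1 Y.
Proof.
move=> c0 eqXY; elim/ltn_ind => i IHi; have := eqXY i.
rewrite /conv !big_ord_recl /= c0 !mulr1n subn0 => E; apply: (addIr _ (etrans E _)).
by congr (_ + _); apply: eq_bigr => k _; rewrite IHi //= /bump /=; have := ltn_ord k; lia.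
Qed.

Lemma conv_sum (I : finType) (X : I -> nat -> R) i :
  \sum_x conv (X x) i = conv (fun j => \sum_x X x j) i.
Proof. by rewrite exchange_big; apply: eq_bigr => k _; rewrite sumrMnl. Qed.

Lemma conv_mull a X i : a * conv X i = conv (fun j => a * X j) i.
Proof. by rewrite mulr_sumr; apply: eq_bigr => k _; rewrite mulrnAr. Qed.

Lemma conv_mulr a X i : conv X i * a = conv (fun j => X j * a) i.
Proof. by rewrite mulr_suml; apply: eq_bigr => k _; rewrite mulrnAl. Qed.

Lemma conv_sum_mul (I : finType) a (X Y : I -> nat -> R) i j :
  a * \sum_x conv (X x) j * conv (Y x) i
    = conv (fun i' => conv (fun j' => a * \sum_x X x j' * Y x i') j) i.
Proof.
under eq_bigr do rewrite conv_mull.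
rewrite conv_sum conv_mull; apply: eq_conv => i'.
under eq_bigr do rewrite conv_mulr.
by rewrite conv_sum conv_mull.
Qed.

Lemma conv_delta (m i : nat) :
  conv (fun j => (m == j)%:R) i = (if (m <= i)%N then c (i - m) else 0%N)%:R.
Proof.
rewrite /conv; case: leqP => [le_mi|lt_im].
  have lt_i : (i - m < i.+1)%N by rewrite ltnS leq_subr.
  rewrite (bigD1 (Ordinal lt_i)) //= subKn // eqxx big1 ?addr0 // => k.
  rewrite -val_eqE /= => neq_k; case: eqP => [m_ik|_]; last exact: mul0rn.
  by have := ltn_ord k; lia.
rewrite big1 // => k _; case: eqP => [m_ik|_]; last exact: mul0rn.
by have := ltn_ord k; lia.
Qed.

End Convolution.

Section Bimahonian.
Variables (d n : nat) (K : splittingFieldType rat) (iota : {rmorphism K -> algC}).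
Variables (zeta : K) (zetaP : d.+1.-primitive_root zeta) (sigma : gal_of {:K}).
Local Notation N := n.+1.
Local Notation W := (wreath d.+1 N).
Local Notation nu := (gal_ext iota sigma).
Local Notation z := (iota zeta).
Local Notation omegaP := (iota_prim_root iota zetaP).
Local Notation A i := (cfRepr (coinv_repr n omegaP i)).
Local Notation conv := (conv (npart d N)).
Implicit Types (u w : W) (i j k : nat).

Lemma gal_zeta : exists r, sigma zeta = zeta ^+ r.
Proof.
have [|r rE] := @prim_rootP _ _ _ zetaP (sigma zeta); last by exists r.
by rewrite -rmorphXn (prim_expr_order zetaP) rmorph1.
Qed.

(** Expand the twisted character of degree j in the twisted irreducible characters: its
    multiplicities are natural numbers, so sigma and conjugation fix them. *)
Lemma coef_bimahonian i j : (bimahonian n iota sigma zetaP)`_i`_j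
  = #|{: W}|%:R^-1 * \sum_w nu (A j w) * A i w.
Proof.
transitivity ('[cfAut nu (A j), ((A i)^*)%CF]); last first.
  rewrite cfdotE cardsT; congr (_ * _); apply: eq_big => [w|w _]; first by rewrite inE.
  by rewrite !cfunE conjCK.
rewrite /bimahonian !coef_sum; under eq_bigr => l _ do
  rewrite coefMC coef_map /= coefCM !coef_fake_degree.
rewrite [cfAut nu (A j) in RHS]cfun_sum_cfdot cfdot_suml [RHS](reindex_inj (aut_Iirr_inj nu)) /=.
apply: eq_bigr => l _; rewrite cfdotZl mulrC; congr (_ * _).
rewrite conjC_IirrE /coinv_char cfdot_conjC -cfdotC aut_IirrE cfdot_aut_irr.
have /natrP[m ->] := Cnat_cfdot_char_irr l (cfRepr_char (coinv_repr n omegaP j)).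
by rewrite rmorph_nat.
Qed.

Section Twist.
Variables (r : nat) (rE : sigma zeta = zeta ^+ r).

Lemma gal_wreath_twist w : gal_wreath zeta sigma w = twist r w.
Proof.
apply: (mono_mx_inj zetaP); rewrite /= (mono_mx_gal _ zetaP); apply/matrixP => i j.
rewrite !mxE /= ffunE; case: (i == _); last exact: rmorph0.
by rewrite rmorphXn /= rE -exprM (prim_expr_mod zetaP).
Qed.

Lemma card_wreath : #|{: W}| = (d.+1 ^ N * N`!)%N.
Proof.
rewrite -sum1_card big_wreath; under eq_bigr do rewrite sum1_card card_ffun !card_ord.
by rewrite sum_nat_const mulnC card_Sn.
Qed.

Local Notation trV w i := (homog_trace i (@pact d n z w^-1%g)).

(** The pairs (a, b) are sorted in two ways: [lexsorted] picks one in each orbit, and [eword_twist]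
    translates this choice after a is permuted by [rkperm b]. *)
Lemma sum_trace_pact i j : #|{: W}|%:R^-1 * \sum_w nu (trV w j) * trV w i
  = \sum_u (count (fun a => eword d a == u) (monos N j))%:R
            * (count (fun b => eword d b == twist r u^-1%g) (monos N i))%:R.
Proof.
pose P (a b : 'X_{1..N}) := [forall p, d.+1 %| b p + r * a p]%N.
transitivity ((\sum_(a <- monos N j) \sum_(b <- monos N i)
    (P a b && lexsorted a b : nat))%:R : algC).
  have W0 : (#|{: W}|%:R : algC) != 0.
    by rewrite pnatr_eq0 -lt0n; apply/card_gt0P; exists 1%g.
  apply: (mulfI W0); rewrite mulrA mulfV // mul1r card_wreath -natrM -mulnA.
  rewrite -sum_stab_lexsorted; last first.
    move=> s a b; apply/forallP/forallP => Pab p; last by rewrite !placeE.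
    by have := Pab (s^-1%g p); rewrite !placeE permKV.
  rewrite big_wreath big_distrr natr_sum; apply: eq_bigr => s _ /=.
  (* Traces count fixed monomials with weights; sigma multiplies the exponents of z by r, whence
     [b k + r * a k]. *)
  transitivity (\sum_(c : {ffun 'I_N -> 'I_d.+1}) \sum_(a <- monos N j) \sum_(b <- monos N i)
     z ^+ (\sum_k c k * (b k + r * a k)) *+ ((place s a == a) && (place s b == b))).
    apply: eq_bigr => c _; rewrite !homog_trace_pactV // rmorph_sum /= mulr_suml big_mkcond /=.
    apply: eq_bigr => a _; rewrite mulr_sumr big_mkcond /=.
    case: (place s a == a) => /=; last by rewrite big1.
    apply: eq_bigr => b _; case: (place s b == b) => //=.
    rewrite mulr1n rmorphXn /= gal_extE rE rmorphXn -exprM -exprD big_distrr -big_split.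
    by congr (_ ^+ _); apply: eq_bigr => k _ /=; rewrite mulnDr mulnCA addnC.
  rewrite exchange_big big_distrr natr_sum; apply: eq_bigr => a _ /=.
  rewrite exchange_big big_distrr natr_sum; apply: eq_bigr => b _ /=.
  rewrite sumrMnl (sum_col_expr (fun p : 'I_N => b p + r * a p)%N omegaP) -mulrnA.
  by rewrite /P -!mulnb !mulnA.
rewrite exchange_big.
transitivity ((\sum_(a <- monos N j) \sum_(b <- monos N i)
    (eword d b == twist r (eword d a)^-1%g : nat))%:R : algC).
  rewrite [in RHS]exchange_big; congr _%:R; apply: eq_bigr => b _.
  rewrite -(big_monos_place _ (rkperm b)); apply: eq_bigr => a _.
  by rewrite eword_twist.
under [RHS]eq_bigr do rewrite -natrM.
rewrite -natr_sum; congr _%:R.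
under [RHS]eq_bigr => u _ do rewrite -sum1_count big_distrl big_mkcond /=.
rewrite [RHS]exchange_big; apply: eq_bigr => a _ /=.
rewrite -[RHS]big_mkcond /= (eq_bigl _ _ (fun u => eq_sym _ u)) big_pred1_eq mul1n.
by rewrite -sum1_count [RHS]big_mkcond.
Qed.

(** Both traces are sums of the same [tau] at [delta u], weighted by [count_eword] on one side and
    by the degree condition on the other. *)
Lemma trace_pact_conv w i : trV w i = conv (fun k => A k w) i.
Proof.
rewrite (homog_trace_pact omegaP).
under eq_bigr => u _ do rewrite count_eword -mulr_natr -conv_delta conv_mull.
rewrite conv_sum; apply: eq_conv => k; rewrite coinv_trace [RHS]big_mkcond.
by apply: eq_bigr => u _; case: eqP => _; rewrite ?mulr1 ?mulr0.
Qed.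

Lemma sum_coinv_char i j : #|{: W}|%:R^-1 * \sum_w nu (A j w) * A i w
  = \sum_(u : W) (fmaj u == j)%:R * (fmaj (twist r u^-1%g) == i)%:R.
Proof.
pose X i' j' := #|{: W}|%:R^-1 * \sum_w nu (A j' w) * A i' w.
(* The factor 1 gives Y the shape required by [conv_sum_mul]. *)
pose Y i' j' : algC := 1 * \sum_(u : W) (fmaj u == j')%:R * (fmaj (twist r u^-1%g) == i')%:R.
suff XY i' j' : conv (fun i' => conv (X i') j') i' = conv (fun i' => conv (Y i') j') i'.
  rewrite -[LHS]/(X i j) -[RHS]mul1r -[RHS]/(Y i j); move: j; apply: (conv_inj (npart0 d N)) => j.
  move: i; apply: (conv_inj (X := fun i => conv (X i) j) (Y := fun i => conv (Y i) j) (npart0 d N)).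
  by move=> i; apply: XY.
rewrite -[LHS]conv_sum_mul -[RHS]conv_sum_mul mul1r.
transitivity (#|{: W}|%:R^-1 * \sum_w nu (trV w j') * trV w i').
  congr (_ * _); apply: eq_bigr => w _; rewrite !trace_pact_conv rmorph_sum /=.
  by congr (_ * _); apply: eq_bigr => k _; rewrite rmorphMn.
by rewrite sum_trace_pact; apply: eq_bigr => u _; rewrite !conv_delta !count_eword.
Qed.

End Twist.

Lemma coef_fmaj_sum (I : finType) (f g : I -> nat) i j :
  (\sum_x (('X^(f x))%:P * 'X^(g x) : {poly {poly algC}}))`_i`_j
    = \sum_x (f x == j)%:R * (g x == i)%:R.
Proof.
rewrite !coef_sum; apply: eq_bigr => x _; rewrite coefCM coefXn (eq_sym i).
case: (g x == i) => /=; first by rewrite !mulr1 coefXn (eq_sym j).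
by rewrite !mulr0 coef0.
Qed.

End Bimahonian.

Theorem theorem1p3 (d n : nat)
    (K : splittingFieldType rat) (iota : {rmorphism K -> algC}) (zeta : K)
    (zetaP : d.+1.-primitive_root zeta) (genK : <<1; zeta>>%VS = fullv)
    (sigma : gal_of {:K}) (sigma_gal : sigma \in 'Gal({:K} / 1)%g) :
  bimahonian n iota sigma zetaP =
    \sum_(w : wreath d.+1 n.+1)
      ('X^(fmaj w))%:P * 'X^(fmaj (gal_wreath zeta sigma (w^-1)%g)).
Proof.
have [r rE] := gal_zeta zetaP sigma.
apply/polyP => i; apply/polyP => j; rewrite coef_bimahonian (sum_coinv_char _ _ _ rE).
rewrite coef_fmaj_sum; apply: eq_bigr => w _.
by rewrite (gal_wreath_twist zetaP rE).
Qed.
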